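(* Let $N>2$, let $1<q<N$, $q\ne2$, let $p=\hat p:=q(1+\frac2N)$, and assume $2<p<\min\{2^*,q^*\}$. Then there exist $0<c_{**}<\hat c_{**}$ such that: (i) if $0<c\le c_{**}$, then $m(c)=0$ and there is no minimizer of $m(c)$; (ii) if $2<q<N$ and $c>\hat c_{**}$, then $m(c)=-\infty$ and there is no minimizer of $m(c)$.
   Context: Functions are real valued. For $1<s<N$, $s^*=\frac{sN}{N-s}$. $D^{1,q}(\mathbb{R}^N)=\{u\in L^{q^*}(\mathbb{R}^N):\nabla u\in L^q(\mathbb{R}^N)\}$ and $X=H^1(\mathbb{R}^N)\cap D^{1,q}(\mathbb{R}^N)$. Set $$I(u)=\tfrac12\|\nabla u\|_2^2+\tfrac1q\|\nabla u\|_q^q-\tfrac1p\|u\|_p^p\quad(u\in X),\qquad S_c=\{u\in X:\|u\|_2^2=c^2\},\qquad m(c)=\inf_{u\in S_c}I(u).$$ A minimizer of $m(c)$ is a $u\in S_c$ with $I(u)=m(c)$. *)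

(* Defs.v *)
From HB Require Import structures.
From mathcomp Require Import all_boot all_order all_algebra.
From mathcomp Require Import all_classical all_reals all_analysis.

Set Implicit Arguments.
Unset Strict Implicit.
Unset Printing Implicit Defensive.
Import Order.TTheory GRing.Theory Num.Theory.
Import numFieldNormedType.Exports.

Local Open Scope classical_set_scope.
Local Open Scope ring_scope.

Definition rV_display : measure_display -> measure_display.
Proof. exact. Qed.

Section measurable_rV.
Context {d} {T : sigmaRingType d} (n : nat).

Let coors : 'I_n -> 'rV[T]_n -> T := fun i v => v ord0 i.

Let rV_set0 : g_sigma_preimage coors set0.
Proof. exact: sigma_algebra0. Qed.

Let rV_setC A : g_sigma_preimage coors A -> g_sigma_preimage coors (~` A).
Proof. exact: sigma_algebraC. Qed.

Let rV_bigcup (F : _^nat) : (forall i, g_sigma_preimage coors (F i)) ->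
  g_sigma_preimage coors (\bigcup_i (F i)).
Proof. exact: sigma_algebra_bigcup. Qed.

(* Product sigma-algebra, as for [n.-tuple T]; over the reals it is the Borel
   sigma-algebra of R^n. *)
HB.instance Definition _ := @isMeasurable.Build (rV_display d)
  'rV[T]_n (g_sigma_preimage coors) rV_set0 rV_setC rV_bigcup.

End measurable_rV.

Section measurable_rV_theory.
Context {d} {T : measurableType d}.

Lemma measurable_coord n (i : 'I_n) :
  measurable_fun [set: 'rV[T]_n] (fun v => v ord0 i).
Proof.
move=> _ Y mY; rewrite setTI; apply: sub_sigma_algebra => /=.
rewrite -bigcup_seq/=; exists i => /=; first by rewrite mem_index_enum.
by exists Y => //; rewrite setTI.
Qed.

Lemma measurable_fun_rVP {d'} {U : measurableType d'} n (f : U -> 'rV[T]_n) :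
  measurable_fun [set: U] f <->
  forall i, measurable_fun [set: U] (fun x => f x ord0 i).
Proof.
split=> [mf i|mf].
  exact: (measurableT_comp (measurable_coord i) mf).
suff h : @measurable _ 'rV[T]_n `<=`
    image_set_system setT f (@measurable _ U).
  by move=> _ A mA; exact: h.
apply: smallest_sub.
  by apply: sigma_algebra_image; exact: sigma_algebra_measurable.
rewrite -bigcup_seq/= => A [i _ [B mB <-]].
rewrite /image_set_system/= setTI.
exact: mf.
Qed.

End measurable_rV_theory.

Section lebesgue_measure_rV.
Context {R : realType}.

Definition rV_cons n (p : measurableTypeR R * 'rV[R]_n) : 'rV[R]_n.+1 :=
  row_mx (const_mx p.1 : 'rV_1) p.2.

Definition rV_uncons n (v : 'rV[R]_n.+1) : measurableTypeR R * 'rV[R]_n :=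
  (v ord0 ord0, \row_i v ord0 (lift ord0 i)).

Lemma rV_cons0 n (p : measurableTypeR R * 'rV[R]_n) : rV_cons p ord0 ord0 = p.1.
Proof. by rewrite mxE; case: splitP => // j _; rewrite mxE. Qed.

Lemma rV_consS n (p : measurableTypeR R * 'rV[R]_n) i :
  rV_cons p ord0 (lift ord0 i) = p.2 ord0 i.
Proof.
rewrite mxE; case: splitP => [j|k]; first by rewrite ord1.
by rewrite lift0 => -[ik]; congr (p.2 _ _); apply/val_inj.
Qed.

Lemma rV_consK n : cancel (@rV_cons n) (@rV_uncons n).
Proof.
move=> [x v]; congr pair; first by rewrite rV_cons0.
by apply/rowP => i; rewrite mxE rV_consS.
Qed.

Lemma rV_unconsK n : cancel (@rV_uncons n) (@rV_cons n).
Proof.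
move=> v; apply/rowP => i; case: (unliftP ord0 i) => [j ->|->].
  by rewrite rV_consS mxE.
by rewrite rV_cons0.
Qed.

Lemma measurable_rV_cons n : measurable_fun setT (@rV_cons n).
Proof.
apply/measurable_fun_rVP => i; case: (unliftP ord0 i) => [j ->|->].
  under eq_fun do rewrite rV_consS.
  exact: (measurableT_comp (measurable_coord j) measurable_snd).
by under eq_fun do rewrite rV_cons0; exact: measurable_fst.
Qed.

Lemma measurable_rV_uncons n : measurable_fun setT (@rV_uncons n).
Proof.
apply: measurable_fun_pair; first exact: measurable_coord.
apply/measurable_fun_rVP => i.
by under eq_fun do rewrite mxE; exact: measurable_coord.
Qed.

Section step.
Variables (n : nat) (m : {sigma_finite_measure set 'rV[R]_n -> \bar R}).

Definition lebesgue_rV_step : set 'rV[R]_n.+1 -> \bar R :=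
  pushforward (lebesgue_measure \x m)%E (@rV_cons n).

Let step0 : lebesgue_rV_step set0 = 0%E.
Proof. by apply: measure0; exact: measurable_rV_cons. Qed.

Let step_ge0 A : (0 <= lebesgue_rV_step A)%E.
Proof. by apply: measure_ge0; exact: measurable_rV_cons. Qed.

Let step_sigma_additive : semi_sigma_additive lebesgue_rV_step.
Proof. by apply: measure_semi_sigma_additive; exact: measurable_rV_cons. Qed.

HB.instance Definition _ := isMeasure.Build _ _ _ lebesgue_rV_step
  step0 step_ge0 step_sigma_additive.

Lemma lebesgue_rV_stepE (A : set R) (B : set 'rV[R]_n) :
  measurable A -> measurable B ->
  lebesgue_rV_step (@rV_uncons n @^-1` (A `*` B)) = (lebesgue_measure A * m B)%E.
Proof.
move=> mA mB; rewrite /lebesgue_rV_step /pushforward -comp_preimage.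
rewrite (_ : _ \o _ = id); last exact/funext/rV_consK.
by rewrite preimage_id product_measure1E.
Qed.

Let step_sigma_finite : sigma_finite setT lebesgue_rV_step.
Proof.
have /sigma_finiteP[F [TF ndF Foo]] := sigma_finiteT (@lebesgue_measure R).
have /sigma_finiteP[G [TG ndG Goo]] := sigma_finiteT m.
exists (fun k => @rV_uncons n @^-1` (F k `*` G k)).
  rewrite -preimage_bigcup -[LHS](@preimage_setT _ _ (@rV_uncons n)).
  congr (_ @^-1` _); rewrite -setXTT TF TG predeqE => -[x y]; split.
    move=> [/= [k _ Fkx] [l _ Gly]]; exists (maxn k l) => //; split.
    - by move: x Fkx; exact/subsetPset/ndF/leq_maxl.
    - by move: y Gly; exact/subsetPset/ndG/leq_maxr.
  by move=> [k _ []/= ? ?]; split; exists k.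
move=> k; have [mF ?] := Foo k; have [mG ?] := Goo k; split.
  rewrite -[X in measurable X]setTI; apply: measurable_rV_uncons => //.
  exact: measurableX.
by rewrite lebesgue_rV_stepE// lte_mul_pinfty// ge0_fin_numE.
Qed.

HB.instance Definition _ :=
  Measure_isSigmaFinite.Build _ _ _ lebesgue_rV_step step_sigma_finite.

End step.

Fixpoint lebesgue_rV n : {sigma_finite_measure set 'rV[R]_n -> \bar R} :=
  if n is k.+1 then lebesgue_rV_step (lebesgue_rV k) else dirac (0 : 'rV[R]_0).

(* [lebesgue_rV] gives boxes their volume, which characterizes it. *)
Lemma lebesgue_rV_box n (A : 'I_n -> set R) : (forall i, measurable (A i)) ->
  measurable [set v : 'rV[R]_n | forall i, A i (v ord0 i)] /\
  lebesgue_rV n [set v : 'rV[R]_n | forall i, A i (v ord0 i)] =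
    (\prod_(i < n) lebesgue_measure (A i))%E.
Proof.
elim: n A => [|n IHn] A mA.
  rewrite big_ord0 (_ : [set _ | _] = setT); last first.
    by apply/seteqP; split=> // v _ [].
  by split; [exact: measurableT|rewrite /= diracE mem_set// => -[]].
have [mB leb_B] := IHn (fun i => A (lift ord0 i)) (fun i => mA _).
have -> : [set v : 'rV[R]_n.+1 | forall i, A i (v ord0 i)] =
    @rV_uncons n @^-1` (A ord0 `*`
      [set v : 'rV[R]_n | forall i, A (lift ord0 i) (v ord0 i)]).
  apply/seteqP; split=> v /=.
    by move=> Av; split=> // i; rewrite mxE.
  move=> [A0 AS] i; case: (unliftP ord0 i) => [j ->|->] //.
  by have := AS j; rewrite mxE.
split; last by rewrite big_ord_recl -leb_B; exact: lebesgue_rV_stepE.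
rewrite -[X in measurable X]setTI; apply: measurable_rV_uncons => //.
by apply: measurableX => //; exact: mA.
Qed.

End lebesgue_measure_rV.

Section sobolev.
Context {R : realType} (n : nat).
Implicit Types (u : 'rV[R]_n -> R) (g : 'rV[R]_n -> 'rV[R]_n).

Local Notation mu := (@lebesgue_rV R n).

(* The library norm of ['rV[R]_n] is the max norm. *)
Definition euclidean_norm (v : 'rV[R]_n) : R :=
  Num.sqrt (\sum_i v ord0 i ^+ 2).

Definition partial (i : 'I_n) (phi : 'rV[R]_n -> R) : 'rV[R]_n -> R :=
  fun x => 'D_(delta_mx ord0 i) phi x.

Definition iter_partial (s : seq 'I_n) (phi : 'rV[R]_n -> R) : 'rV[R]_n -> R :=
  foldr partial phi s.

(* C^oo: partial derivatives of all orders exist and are continuous. *)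
Definition smooth (phi : 'rV[R]_n -> R) : Prop :=
  forall s : seq 'I_n, continuous (iter_partial s phi) /\
    forall i x, derivable (iter_partial s phi) x (delta_mx ord0 i).

Definition test_function (phi : 'rV[R]_n -> R) : Prop :=
  smooth phi /\ compact (closure [set x | phi x != 0]).

Definition locally_integrable_rV u : Prop :=
  measurable_fun setT u /\
  forall K, compact K -> (\int[mu]_(x in K) `|u x|%:E < +oo)%E.

Definition is_weak_gradient u g : Prop :=
  [/\ locally_integrable_rV u,
      forall i, locally_integrable_rV (fun x => g x ord0 i) &
      forall phi, test_function phi -> forall i,
        (\int[mu]_x (u x * partial i phi x)%:E =
         - \int[mu]_x (g x ord0 i * phi x)%:E)%E].

Definition weakly_differentiable u : Prop := exists g, is_weak_gradient u g.

(* A representative of the weak gradient (which is unique up to null sets),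
   and the zero field if [u] has no weak gradient. *)
Definition weak_gradient u : 'rV[R]_n -> 'rV[R]_n :=
  xget (fun=> 0) [set g | is_weak_gradient u g].

Definition gradient_norm u : 'rV[R]_n -> R :=
  fun x => euclidean_norm (weak_gradient u x).

Definition gradient_in_L (s : R) u : Prop :=
  weakly_differentiable u /\ gradient_norm u \in Lfun mu s%:E.

Definition sobolev_exponent (s : R) : R := s * n%:R / (n%:R - s).

Definition space_H1 : set ('rV[R]_n -> R) :=
  [set u | u \in Lfun mu 2%:E /\ gradient_in_L 2 u].

Definition space_D1 (q : R) : set ('rV[R]_n -> R) :=
  [set u | u \in Lfun mu (sobolev_exponent q)%:E /\ gradient_in_L q u].

Definition space_X (q : R) : set ('rV[R]_n -> R) := space_H1 `&` space_D1 q.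

Definition normL (s : R) u : \bar R := ('N[mu]_(s%:E) [EFin \o u])%E.

(* Extended-real valued: finite on [space_X q] for 2 <= p <= q^*. *)
Definition energy (q p : R) u : \bar R :=
  (2^-1%:E * normL 2 (gradient_norm u) `^ 2
   + q^-1%:E * normL q (gradient_norm u) `^ q
   - p^-1%:E * normL p u `^ p)%E.

Definition sphere (q c : R) : set ('rV[R]_n -> R) :=
  [set u | space_X q u /\ (normL 2 u `^ 2 = (c ^+ 2)%:E)%E].

Definition min_energy (q p c : R) : \bar R :=
  ereal_inf (energy q p @` sphere q c).

Definition minimizer (q p c : R) u : Prop :=
  sphere q c u /\ energy q p u = min_energy q p c.

End sobolev.

(* Main.v *)
(** At the exponent p = q (1 + 2/N) the Gagliardo-Nirenberg inequality reads
    |u|_p^p <= K |u|_2^(2q/N) |grad u|_q^q, so that a small mass makes the energy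
    of every competitor positive. The mass preserving dilations l^(-N/2) w(x/l)
    bring the energy to 0 as l -> oo; since |grad u|_q^q and |u|_p^p scale alike,
    and faster than |grad u|_2^2 when q > 2, they bring it to -oo as l -> 0 when
    the mass is large.

    The inequality is derived without the Sobolev embedding. A weak gradient
    satisfies |u(. + y) - u|_q <= C r |grad u|_q for y in [0,r]^N. Averaging over y
    with r^N = 2 |{|u| > t/2}| gives
    t^q |{|u| > t}| <= C |{|u| > t/2}|^(q/N) |grad u|_q^q.
    As u lies in L^s, where s is the Sobolev exponent of q, this self-improves to
    the weak-type bound t^s |{|u| > t}| <= C |grad u|_q^s, which is interpolated
    with the L^2 norm, because 2 < p < s. *)

Require Import Defs.
From mathcomp Require Import all_boot all_order all_algebra.
From mathcomp Require Import all_classical all_reals all_analysis.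
From mathcomp Require Import measurable_realfun ring lra.
Set Implicit Arguments.
Unset Strict Implicit.
Unset Printing Implicit Defensive.
Import Order.TTheory GRing.Theory Num.Theory.
Import numFieldNormedType.Exports.
Local Open Scope classical_set_scope.
Local Open Scope ring_scope.

(** * Lebesgue measure on R^n *)

(** A weak gradient is accessible only through its pairings with test functions, so every fact about
    [u] is extracted from explicit ones: products of one-variable bumps, which tend to indicators of
    half-open boxes, and products in which one factor is integrated over a window of length [h]. The
    latter turn the definition into [u (x + h e_i) - u x = \int_0^h g_i (x + s e_i) ds] for almost
    every [x], without mollification. The value of [p] enters the interpolation once: it gives
    [(p - 2) / (s - 2) = (N - q) / N], the inverse of the power of |grad u|_q^q in the weak-type
    bound, so that |grad u|_q^q comes out with power one. Positivity of the energy must be strict to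
    exclude minimizers. If |grad u|_q vanishes, the inequality forces |u|_p = 0, hence [u = 0]
    almost everywhere, against the positive mass. For the dilated competitors only the mass is
    computed exactly; the other norms are compared with volumes of boxes of size [l], which replaces
    the change of variables. *)

Section boxes.
Context {R : realType} (n : nat).
Implicit Types a b v x : 'rV[R]_n.
Local Notation mu := (@lebesgue_rV R n).

Definition box a b : set 'rV[R]_n :=
  [set x | forall i, x ord0 i \in `]a ord0 i, b ord0 i]].

Lemma measurable_box a b : measurable (box a b).
Proof. exact: (lebesgue_rV_box (A := fun i => `]a ord0 i, b ord0 i]%classic) _).1. Qed.

Lemma lebesgue_boxE a b :
  mu (box a b) = (\prod_(i < n) lebesgue_measure `]a ord0 i, b ord0 i]%classic)%E.
Proof. exact: (lebesgue_rV_box (A := fun i => `]a ord0 i, b ord0 i]%classic) _).2. Qed.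

Lemma lebesgue_box_max a b :
  mu (box a b) = (\prod_(i < n) Num.max 0 (b ord0 i - a ord0 i))%:E.
Proof.
rewrite lebesgue_boxE (big_morph _ EFinM (erefl 1%:E)).
apply: eq_bigr => i _; rewrite lebesgue_measure_itv/= lte_fin -subr_gt0.
by case: ltP.
Qed.

Lemma lebesgue_box a b : (forall i, a ord0 i <= b ord0 i) ->
  mu (box a b) = (\prod_(i < n) (b ord0 i - a ord0 i))%:E.
Proof.
move=> ab; rewrite lebesgue_box_max; congr (_%:E); apply: eq_bigr => i _.
by apply/max_idPr; rewrite subr_ge0.
Qed.

Lemma lebesgue_box_lty a b : (mu (box a b) < +oo)%E.
Proof. by rewrite lebesgue_box_max ltry. Qed.

Definition boxes : set (set 'rV[R]_n) := [set box ab.1 ab.2 | ab in setT].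

Definition cube (M : R) := box (const_mx (- M)) (const_mx M).

Lemma cubeP M x : cube M x <-> forall i, - M < x ord0 i <= M.
Proof. by split => h i; have := h i; rewrite !mxE in_itv. Qed.

Lemma boxes_setI : setI_closed boxes.
Proof.
move=> _ _ [[a b] _ <-] [[c d] _ <-].
exists (\row_i Num.max (a ord0 i) (c ord0 i), \row_i Num.min (b ord0 i) (d ord0 i)) => //=.
apply/seteqP; split => x /=.
  move=> h; split=> i; have := h i; rewrite !mxE !in_itv/= gt_max le_min;
  by move=> /andP[/andP[? ?] /andP[? ?]]; apply/andP.
move=> [h1 h2] i; have := h1 i; have := h2 i; rewrite !mxE !in_itv/= gt_max le_min.
by move=> /andP[-> ->] /andP[-> ->].
Qed.

Lemma bigcup_cube : \bigcup_k cube k%:R = setT.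
Proof.
apply/seteqP; split => // x _.
have [K hK] : exists K : nat, forall i, `|x ord0 i| < K%:R.
  exists (\sum_i (Num.trunc `|x ord0 i|).+1)%N => i.
  rewrite (lt_le_trans (truncnS_gt _))// ler_nat.
  by rewrite (bigD1 i)//= leq_addr.
exists K => //; apply/cubeP => i.
by have := hK i; rewrite ltr_norml => /andP[-> /ltW].
Qed.

(** The coordinates generate the sigma-algebra, and the preimage of an interval under one coordinate
    is a countable union of boxes whose other sides exhaust the line. Boxes thus form a generating
    pi-system, on which uniqueness of measures and Dynkin induction run. *)
Lemma measurable_boxes : @measurable _ 'rV[R]_n = <<s boxes >>.
Proof.
apply/seteqP; split; last first.
  by apply: smallest_sub; [exact: sigma_algebra_measurable|move=> _ [ab _ <-]; exact: measurable_box].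
apply: smallest_sub; first exact: smallest_sigma_algebra.
rewrite -bigcup_seq/= => A [i _ [B mB <-]]; rewrite setTI.
pose coor (v : 'rV[R]_n) := v ord0 i.
suff h : @measurable _ (measurableTypeR R) `<=` image_set_system setT coor (<<s boxes>>).
  by have := h _ mB; rewrite /image_set_system/= setTI.
apply: smallest_sub.
  by apply: sigma_algebra_image; exact: smallest_sigma_algebra.
move=> _ [[c d] _ <-]; rewrite /image_set_system/= setTI.
have -> : coor @^-1` `]c, d]%classic =
    \bigcup_k (box (\row_j if j == i then c else - k%:R)
                   (\row_j if j == i then d else k%:R)).
  apply/seteqP; split => [x /= xcd|x [k _ h]].
    have [k _ /cubeP hk] : (\bigcup_k cube k%:R) x by rewrite bigcup_cube.
    exists k => // j; rewrite !mxE; case: eqP => [->|_]; first by [].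
    by rewrite in_itv/= hk.
  by have := h i; rewrite !mxE eqxx.
have [_ _ hU] := smallest_sigma_algebra (setT : set 'rV[R]_n) boxes.
apply: hU => k; apply: sub_sigma_algebra.
by exists (\row_j (if j == i then c else - k%:R), \row_j (if j == i then d else k%:R)).
Qed.

Lemma boxes_measure_unique (m1 m2 : {measure set 'rV[R]_n -> \bar R}) :
  (forall a b, (m1 (box a b) < +oo)%E) ->
  (forall a b, m1 (box a b) = m2 (box a b)) ->
  forall A, measurable A -> m1 A = m2 A.
Proof.
move=> foo m12 A mA.
apply: (measure_unique boxes (fun k => cube k%:R)) => //.
- exact: measurable_boxes.
- exact: boxes_setI.
- by move=> k; exists (const_mx (- k%:R), const_mx k%:R).
- exact: bigcup_cube.
- by move=> _ [ab _ <-]; exact: m12.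
- by move=> k; exact: foo.
Qed.

Lemma measurable_shift v : measurable_fun setT (fun x => x + v).
Proof.
apply/measurable_fun_rVP => i; under eq_fun do rewrite mxE.
by apply: measurable_funD => //; exact: measurable_coord.
Qed.

Lemma lebesgue_shift v A : measurable A -> mu ((fun x => x + v) @^-1` A) = mu A.
Proof.
move=> mA; apply/esym.
have key a b : mu (box a b) = pushforward mu (fun x => x + v) (box a b).
  rewrite /pushforward (_ : _ @^-1` _ = box (a - v) (b - v)).
    rewrite !lebesgue_boxE; apply: eq_bigr => i _.
    rewrite !mxE !lebesgue_measure_itv/= !lte_fin ltrD2r; case: ifP => // _.
    by rewrite -!EFinD; congr (_%:E); ring.
  by apply/seteqP; split => x h i; have := h i; rewrite /= !mxE !in_itv/= ltrBlDr lerBrDr.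
have h := @boxes_measure_unique mu (pushforward mu (fun x => x + v)).
apply: h => //; [exact: measurable_shift|exact: lebesgue_box_lty].
Qed.

End boxes.

(** * Translation invariance of integrals *)

Section integral_shift.
Context {R : realType} (n : nat).
Implicit Types v x : 'rV[R]_n.
Local Notation mu := (@lebesgue_rV R n).
Local Open Scope ereal_scope.

Lemma ge0_integral_shift v (f : 'rV[R]_n -> \bar R) :
  measurable_fun setT f -> (forall x, 0 <= f x) ->
  \int[mu]_x f (x + v)%R = \int[mu]_x f x.
Proof.
move=> mf f0.
transitivity (\int[pushforward mu (fun x => (x + v)%R)]_x f x).
  rewrite ge0_integral_pushforward//; exact: measurable_shift.
apply: eq_measure_integral; first exact: measurable_shift.
by move=> mm A mA _; exact: lebesgue_shift.
Qed.

Lemma integral_shift v (f : 'rV[R]_n -> \bar R) :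
  measurable_fun setT f ->
  \int[mu]_x f (x + v)%R = \int[mu]_x f x.
Proof.
move=> mf; rewrite [LHS]integralE [RHS]integralE.
rewrite -(ge0_integral_shift v (f := f^\+))//; last exact: measurable_funepos.
rewrite -(ge0_integral_shift v (f := f^\-))//; last exact: measurable_funeneg.
by congr (_ - _)%E; apply: eq_integral => x _; rewrite !(funeposE,funenegE).
Qed.

Lemma integrable_shift v (f : 'rV[R]_n -> \bar R) :
  mu.-integrable setT f -> mu.-integrable setT (fun x => f (x + v)%R).
Proof.
move=> /integrableP[mf foo]; apply/integrableP; split.
  exact: (measurableT_comp mf (measurable_shift v)).
rewrite (ge0_integral_shift v (f := abse \o f)); last 2 first.
- exact: measurableT_comp.
- by move=> x; exact: abse_ge0.
- exact: foo.
Qed.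

(** On a fixed cube [D] the function is integrable, so the sets [E] with zero integral over [E]
    intersected with [D] form a Dynkin class containing the boxes, hence all measurable sets. This
    gives [f = 0] almost everywhere on [D], and countably many cubes cover the space. *)
Lemma ae_eq0_box (f : 'rV[R]_n -> R) :
  (forall a b, mu.-integrable (box a b) (EFin \o f)) ->
  (forall a b, \int[mu]_(x in box a b) (f x)%:E = 0) ->
  {ae mu, forall x, f x = 0%R}.
Proof.
move=> fi f0.
have cubef k : {ae mu, forall x, cube k%:R x -> (f x)%:E = 0}.
{
  pose D : set 'rV[R]_n := cube k%:R.
  have mD : measurable D by exact: measurable_box.
  have key E : measurable E -> \int[mu]_(x in E `&` D) (f x)%:E = 0.
  {
    rewrite measurable_boxes; move: E.
    apply: (@dynkin_induction _ _ (@boxes R n)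
      (fun E => \int[mu]_(x in E `&` D) (f x)%:E = 0)).
    - exact: measurable_boxes.
    - exact: boxes_setI.
    - by rewrite setTI; exact: f0.
    - move=> _ [[a b] _ <-] /=.
      have [[c d] _ <-] : boxes (box a b `&` D) by apply: boxes_setI;
        [exists (a, b)|exists (const_mx (- k%:R)%R, const_mx k%:R)].
      exact: f0.
    - move=> A mA A0.
      have : \int[mu]_(x in (A `&` D) `|` (~` A `&` D)) (f x)%:E = 0.
        by rewrite -setIUl setUv setTI; exact: f0.
      rewrite integral_setU.
      + by rewrite A0 add0e.
      + exact: measurableI.
      + by apply: measurableI => //; exact: measurableC.
      + rewrite -setIUl setUv setTI; exact: measurable_int (fi _ _).
      + by apply/disj_setPS => x [[? ?] []].
    - move=> F mF tF F0; rewrite setI_bigcupl integral_bigcup.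
      + by rewrite eseries0// => i _ _; exact: F0.
      + by apply: trivIset_setIr.
      + by move=> i; exact: measurableI.
      + rewrite -setI_bigcupl.
        apply: integrableS (fi (const_mx (- k%:R)%R) (const_mx k%:R)).
        * exact: measurable_box.
        * by apply: measurableI => //; exact: bigcupT_measurable.
        * exact: subIsetr.
  }
  apply: integral_ae_eq => //.
  - exact: fi.
  - by move=> E ED mE; rewrite integral0 -(setIidl ED); exact: key.
}
have := ae_foralln cubef.
apply: filterS => x h.
have [k _ hk] : (\bigcup_k cube k%:R) x by rewrite bigcup_cube.
by have [] := h k hk.
Qed.

End integral_shift.

(** * Smooth bumps and test functions *)

Section borel_rV.
Context {R : realType} (n : nat).

(** Balls of the max norm are cubes, so each point of an open set lies in a box with rational
    corners contained in the set; there are countably many such boxes. *)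
Lemma open_measurable_rV (A : set 'rV[R]_n) : open A -> measurable A.
Proof.
move=> oA.
pose F (c : 'rV[rat]_n * 'rV[rat]_n) := box (map_mx ratr c.1) (map_mx ratr c.2) : set 'rV[R]_n.
have -> : A = \bigcup_c (if `[< F c `<=` A >] then F c else set0).
{
  apply/seteqP; split => [x Ax|x [c _]]; last by case: asboolP => // h; exact: h.
  have /nbhs_ballP[e e0 eA] : nbhs x A by apply: open_nbhs_nbhs.
  have /choice[a ha] : forall i, exists r, ratr r \in `]x ord0 i - e, x ord0 i[.
    by move=> i; apply: rat_in_itvoo; rewrite ltrBlDr ltrDl.
  have /choice[b hb] : forall i, exists r, ratr r \in `]x ord0 i, x ord0 i + e[.
    by move=> i; apply: rat_in_itvoo; rewrite ltrDl.
  exists (\row_i a i, \row_i b i) => //.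
  have Fsub : F (\row_i a i, \row_i b i) `<=` A.
    move=> y yF; apply: eA; split => // i j; rewrite ord1.
    have := yF j; have := ha j; have := hb j; rewrite !mxE !in_itv/= => hb' ha' hy.
    rewrite /ball/= distrC ltr_norml; move: hb' ha' hy; lra.
  rewrite asboolT// => i.
  have := ha i; have := hb i; rewrite !mxE !in_itv/= => /andP[? _] /andP[_ ?].
  by apply/andP; split => //; exact: ltW.
}
apply: countable_bigcupT_measurable; first exact: countableP.
by move=> c; case: ifP => // _; exact: measurable_box.
Qed.

Lemma continuous_measurable_rV (f : 'rV[R]_n -> R) :
  continuous f -> measurable_fun setT f.
Proof.
move=> /continuousP cf; apply: (measurability _ (RGenOInfty.measurableE R)) => //.
move=> /= _ [_ [a ->] <-]; rewrite setTI; apply: open_measurable_rV.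
exact/cf/rray_open.
Qed.

End borel_rV.

Section smooth1.
Context {R : realType}.
Implicit Types f g : R -> R.

Fixpoint differentiable_upto (n : nat) f : Prop :=
  if n is k.+1 then (forall x, derivable f x 1) /\ differentiable_upto k (derive1 f)
  else True.

Definition smooth1 f := forall n, differentiable_upto n f.

Lemma smooth1_derivable f x : smooth1 f -> derivable f x 1.
Proof. by move=> /(_ 1%N)[]. Qed.

Lemma smooth1_derive1 f : smooth1 f -> smooth1 (derive1 f).
Proof. by move=> sf n; have [] := sf n.+1. Qed.

Lemma derivable_smooth1 f : (forall x, derivable f x 1) -> smooth1 (derive1 f) -> smooth1 f.
Proof. by move=> df sf' [|n]//; split => //; exact: sf'. Qed.

Lemma smooth1_continuous f : smooth1 f -> continuous f.
Proof.
move=> sf x; apply/differentiable_continuous/derivable1_diffP.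
exact: smooth1_derivable.
Qed.

Lemma differentiable_uptoW n f : differentiable_upto n.+1 f -> differentiable_upto n f.
Proof.
elim: n f => [//|n IH] f [df1 df2]; split => //; exact: IH.
Qed.

Lemma differentiable_uptoD n f g : differentiable_upto n f -> differentiable_upto n g ->
  differentiable_upto n (fun x => f x + g x).
Proof.
elim: n f g => [//|n IH] f g [df df'] [dg dg']; split.
  by move=> x; apply: derivableD.
rewrite (_ : derive1 _ = fun x => (derive1 f) x + (derive1 g) x); first exact: IH.
by apply/funext => x; rewrite !derive1E deriveD.
Qed.

Lemma differentiable_uptoM n f g : differentiable_upto n f -> differentiable_upto n g ->
  differentiable_upto n (fun x => f x * g x).
Proof.
elim: n f g => [//|n IH] f g dfn dgn; have [df df'] := dfn; have [dg dg'] := dgn; split.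
  by move=> x; apply: derivableM.
rewrite (_ : derive1 _ = fun x => f x * (derive1 g) x + g x * (derive1 f) x).
  by apply: differentiable_uptoD; apply: IH => //; exact: differentiable_uptoW.
by apply/funext => x; rewrite !derive1E deriveM.
Qed.

Lemma smooth1D f g : smooth1 f -> smooth1 g -> smooth1 (fun x => f x + g x).
Proof. by move=> sf sg n; exact: differentiable_uptoD. Qed.

Lemma smooth1M f g : smooth1 f -> smooth1 g -> smooth1 (fun x => f x * g x).
Proof. by move=> sf sg n; exact: differentiable_uptoM. Qed.

Lemma is_derive_affine (a b x : R) : is_derive x 1 (fun y => a * y + b) a.
Proof.
have : is_derive x 1 (fun y : R => a * y + b) (a *: 1 + 0) by exact: _.
by rewrite addr0 scaler1.
Qed.

Lemma smooth1_cst (c : R) : smooth1 (cst c).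
Proof.
move=> n; elim: n c => [//|n IH] c; split; first by move=> x; exact: derivable_cst.
rewrite (_ : derive1 (cst c) = cst 0); first exact: IH.
by apply/funext => x; rewrite derive1E derive_cst.
Qed.

Lemma smooth1_affine f (a b : R) : smooth1 f -> smooth1 (fun x => f (a * x + b)).
Proof.
move=> sf n; elim: n f sf => [//|n IH] f sf.
have D (x : R) : is_derive x 1 (fun x => f (a * x + b)) ((derive1 f) (a * x + b) * a).
  apply: (@is_derive1_comp _ f (fun x => a * x + b)); last exact: is_derive_affine.
  by rewrite derive1E; apply: DeriveDef => //; exact: smooth1_derivable.
split; first by move=> x; exact: (ex_derive (is_derive := D x)).
rewrite (_ : derive1 _ = fun x => (derive1 f) (a * x + b) * cst a x).
  by apply: differentiable_uptoM; [exact/IH/smooth1_derive1|exact: smooth1_cst].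
by apply/funext => x; rewrite derive1E (derive_val (is_derive := D x)).
Qed.

(* These functions are closed under differentiation, hence smooth. *)
Definition flat (p : {poly R}) (x : R) : R :=
  if 0 < x then p.[x^-1] * expR (- x^-1) else 0.

(** With [y = x^-1], the estimate [y ^+ i.+1 <= (i.+1)! * expR y] applied to each monomial gains one
    power of [x] over boundedness. This is what differentiability at 0 requires. *)
Lemma flat_bound p : exists2 C, 0 < C & forall x, `|flat p x| <= C * `|x|.
Proof.
exists (\sum_(i < size p) `|p`_i| * (i.+1)`!%:R + 1).
  by rewrite ltr_wpDl// sumr_ge0// => i _; rewrite mulr_ge0.
move=> x; rewrite /flat; case: ltP => [x0|_]; last first.
  by rewrite normr0 mulr_ge0// addr_ge0// sumr_ge0// => i _; rewrite mulr_ge0.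
set y := x^-1; have y0 : 0 < y by rewrite invr_gt0.
rewrite (gtr0_norm x0) -(invrK x) -/y ler_pdivlMr//.
rewrite normrM (gtr0_norm (expR_gt0 _)) horner_coef.
apply: (@le_trans _ _ (\sum_(i < size p) `|p`_i| * (i.+1)`!%:R)); last by rewrite lerDl.
rewrite -mulrA; apply: (le_trans (ler_wpM2r _ (ler_norm_sum _ _ _))).
  by rewrite mulr_ge0// ?expR_ge0// ltW.
rewrite mulr_suml; apply: ler_sum => i _.
rewrite normrM -mulrA ler_wpM2l// normrX (gtr0_norm y0).
rewrite mulrC -mulrA -exprS expRN mulrC ler_pdivrMr ?expR_gt0// mulrC.
rewrite -ler_pdivrMr ?ltr0n ?fact_gt0//.
by apply: le_trans (expR_ge1Dxn i (ltW y0)); rewrite lerDr.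
Qed.

Lemma is_derive_flat p (x : R) : is_derive x 1 (flat p) (flat ('X^2 * (p - p^`())) x).
Proof.
have [x0|x0|x0] := ltgtP x 0.
- apply: (@near_eq_is_derive _ _ _ (cst 0)).
    near=> y; rewrite /flat/= ifF//; apply/negbTE; rewrite -leNgt; apply/ltW.
    by near: y; exact: lt_nbhsl.
  by rewrite /flat ltNge (ltW x0)/=; exact: is_derive_cst.
- pose g (y : R) : R := p.[y^-1] * expR (- y^-1).
  apply: (@near_eq_is_derive _ _ _ g).
    near=> y; rewrite /flat ifT//; near: y; exact: lt_nbhsr.
  have xn0 : x != 0 by rewrite gt_eqF.
  have DV : is_derive x 1 (fun y => y^-1) (- x ^- 2).
    by have := @is_deriveV R id x 1 1 xn0 (is_derive_id _ _); rewrite scaler1.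
  have D1 := @is_derive1_comp R (horner p) _ x _ _ (is_derive_poly p _) DV.
  have D2 : is_derive x 1 (fun y => expR (- y^-1)) (expR (- x^-1) * x ^- 2).
    apply: (@is_derive1_comp R expR (fun y => - y^-1)).
    by have := is_deriveN DV; rewrite opprK.
  have := is_deriveM D1 D2; rewrite /flat x0 !hornerE.
  move=> /is_derive_eq; apply.
  rewrite /= /GRing.scale/= -exprVn; ring.
(* The difference quotient at 0 is [flat ('X * p) h], which tends to 0 by [flat_bound]. *)
- subst x; have [C C0 hC] := flat_bound ('X * p).
  have f0 q : flat q 0 = 0 by rewrite /flat ltxx.
  rewrite f0.
  suff h : (fun h => h^-1 *: ((flat p \o shift 0) (h *: 1) - flat p 0)) @ 0^' --> (0 : R).
    apply: DeriveDef; first by apply/cvg_ex; exists 0.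
    exact: cvg_lim h.
  apply/cvgrPdist_lt => e e0; near=> h.
  have h0 : h != 0 by near: h; exact: nbhs_dnbhs_neq.
  rewrite sub0r normrN f0 subr0/= addr0 /GRing.scale/= mulr1.
  have -> : h^-1 * flat p h = flat ('X * p) h.
    by rewrite /flat; case: ifP => _; rewrite ?mulr0// hornerM hornerX mulrA.
  apply: le_lt_trans (hC _) _; rewrite mulrC -ltr_pdivlMr//.
  near: h; apply: dnbhs0_lt; exact: divr_gt0.
Unshelve. all: by end_near. Qed.

Lemma smooth1_flat p : smooth1 (flat p).
Proof.
move=> n; elim: n p => [//|n IH] p; split.
  by move=> x; exact: (ex_derive (is_derive := is_derive_flat p x)).
rewrite (_ : derive1 _ = flat ('X^2 * (p - p^`()))); first exact: IH.
by apply/funext => x; rewrite derive1E (derive_val (is_derive := is_derive_flat p x)).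
Qed.

(* The shift in the second factor makes the limit in [k] equal to 1 at [b]. *)
Definition bump (k : nat) (a b x : R) : R :=
  flat 1 (k.+1%:R * (x - a)) * flat 1 ((k.+1 ^ 2)%:R * (b - x) + k.+1%:R).

Lemma smooth1_bump k a b : smooth1 (bump k a b).
Proof.
have h (c d : R) (g : R -> R) : (forall x, g x = c * x + d) -> smooth1 (fun x => flat 1 (g x)).
  by move=> /funext ->; exact/smooth1_affine/smooth1_flat.
apply: smooth1M.
  by apply: (h k.+1%:R (- k.+1%:R * a)) => x; ring.
by apply: (h (- (k.+1 ^ 2)%:R) ((k.+1 ^ 2)%:R * b + k.+1%:R)) => x; ring.
Qed.

Lemma flat1E x : flat 1 x = if 0 < x then expR (- x^-1) else 0.
Proof. by rewrite /flat hornerE mul1r. Qed.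

Lemma flat1_ge0 x : 0 <= flat 1 x.
Proof. by rewrite flat1E; case: ifP => // _; exact: expR_ge0. Qed.

Lemma flat1_le1 x : flat 1 x <= 1.
Proof.
rewrite flat1E; case: ltP => // x0.
by rewrite -expR0 ler_expR oppr_le0 invr_ge0 ltW.
Qed.

Lemma bump_ge0 k a b x : 0 <= bump k a b x.
Proof. by rewrite mulr_ge0// flat1_ge0. Qed.

Lemma bump_le1 k a b x : bump k a b x <= 1.
Proof. by rewrite mulr_ile1// ?flat1_ge0// flat1_le1. Qed.

(** The second factor already vanishes from [b + k.+1%:R^-1] on; [b + 1] is a bound uniform in [k],
    as dominated convergence needs. *)
Lemma bump_out k a b x : ~~ (a < x < b + 1) -> bump k a b x = 0.
Proof.
have k0 : 0 < k.+1%:R :> R by [].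
rewrite negb_and -!leNgt /bump !flat1E => /orP[xa|bx].
  by rewrite (ltNge 0) pmulr_rle0// subr_le0 xa mul0r.
rewrite [X in _ * X](_ : _ = 0) ?mulr0// ltNge natrX.
rewrite (_ : _ <= _ = true)//; set k1 : R := k.+1%:R in k0 *.
have : 0 <= k1 * (k1 * (x - b - 1) + (k1 - 1)).
  rewrite mulr_ge0 ?(ltW k0)// addr_ge0// ?subr_ge0 ?ler1n//.
  by rewrite mulr_ge0 ?(ltW k0)//; lra.
by lra.
Qed.

(** Inside the interval both arguments of [flat 1] grow at least linearly in [k], also at [x = b],
    where the second one is [k.+1]. Beyond [b] the quadratic coefficient makes the second argument
    negative for large [k]. The limit is thus the indicator of the half-open interval at every
    point. *)
Lemma bump_cvg a b x :
  (fun k => bump k a b x) @ \oo --> ((a < x <= b)%R%:R : R).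
Proof.
have flatcvg c (w : nat -> R) : 0 < c -> (forall k, c * k.+1%:R <= w k) ->
    flat 1 (w k) @[k --> \oo] --> (1 : R).
{
  move=> c0 hw.
  have w0 k : 0 < w k by apply: lt_le_trans (hw k); rewrite mulr_gt0.
  apply: (@squeeze_cvgr _ _ _ _ (fun k => 1 - c^-1 * k.+1%:R^-1) (cst 1)).
  - near=> k; rewrite flat1_le1 andbT flat1E w0.
    apply: le_trans (expR_ge1Dx _); rewrite lerD2l lerN2 -invfM.
    by rewrite lef_pV2 ?posrE// mulr_gt0.
  - rewrite -[X in _ --> X](subr0 1) -[X in _ --> _ - X](mulr0 c^-1).
    apply: cvgB; first exact: cvg_cst.
    apply: cvgM; [exact: cvg_cst|exact: cvg_harmonic].
  - exact: cvg_cst.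
}
have [ax|xa] := ltP a x; last first.
  rewrite (_ : (fun _ => _) = cst 0); first exact: cvg_cst.
  by apply/funext => k; rewrite bump_out// (ltNge a) xa.
have [xb|bx] := leP x b.
  rewrite /= -[X in _ --> X](mulr1 1); apply: cvgM.
    by apply: (@flatcvg (x - a)) => [|k]; rewrite ?subr_gt0// mulrC.
  apply: (@flatcvg 1) => // k; rewrite mul1r lerDr mulr_ge0//.
  by rewrite subr_ge0.
rewrite /=; apply: cvg_near_cst; near=> k.
rewrite /bump [X in _ * X]flat1E ltNge (_ : _ <= _ = true) ?mulr0//.
have hk : (x - b)^-1 <= k.+1%:R.
  by rewrite ltW// (lt_le_trans (truncnS_gt _))// ler_nat ltnS; near: k; exact: nbhs_infty_ge.
have xb0 : 0 < x - b by rewrite subr_gt0.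
have k0 : 0 < k.+1%:R :> R by [].
have : 1 <= k.+1%:R * (x - b) by rewrite -ler_pdivrMr// div1r.
by rewrite natrX; nra.
Unshelve. all: by end_near. Qed.

End smooth1.

(** * Primitives and sliding integrals of functions with bounded support *)

Section bounded_support.
Context {R : realType}.
Local Notation leb := (@lebesgue_measure R).
Implicit Types (f : R -> R) (M : R).

Definition vanishes_off M f := forall x, M < `|x| -> f x = 0.

Lemma vanishes_off_derive1 M f : vanishes_off M f -> vanishes_off M (derive1 f).
Proof.
move=> f0 x xM; rewrite derive1E -(derive_cst (0 : R) x 1).
apply: near_eq_derive; near=> y; apply: f0.
near: y.
have : {for x, continuous (fun y : R => `|y|)} by exact: norm_continuous.
by move/cvgr_gt; apply.
Unshelve. all: by end_near. Qed.

Lemma vanishes_off_integrable M f : continuous f -> vanishes_off M f ->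
  leb.-integrable setT (EFin \o f).
Proof.
move=> cf f0.
have -> : EFin \o f = (EFin \o f) \_ `[- M, M]%classic.
  apply/funext => x; rewrite patchE; case: ifPn => // /negP h.
  rewrite /= f0// ltNge; apply/negP; rewrite ler_norml => hx.
  by apply: h; rewrite inE/= in_itv.
have fi : leb.-integrable `[- M, M] (EFin \o f).
  apply: continuous_compact_integrable; first exact: segment_compact.
  exact: continuous_subspaceT.
by move/integrable_mkcond : fi; apply; exact: measurable_itv.
Qed.

Definition primitive f x := \int[leb]_(t in `]-oo, x]) f t.

Lemma is_derive_primitive M f (x : R) : continuous f -> vanishes_off M f ->
  is_derive x 1 (primitive f) (f x).
Proof.
move=> cf f0; have fi := vanishes_off_integrable cf f0.
have x1 : x < x + 1 by rewrite ltrDl.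
have fi1 : leb.-integrable [set` Interval -oo%O (BRight (x + 1))] (EFin \o f).
  exact: integrableS fi.
have [|d e] := continuous_FTC1 x1 fi1 _ (cf x); first by rewrite /= ltNyr.
by apply: DeriveDef; [exact: d|rewrite -derive1E; exact: e].
Qed.

(** The integral of [f] over [[t - h, t]], that is, the convolution of [f] with the indicator of
    [[0, h]]. Written with primitives, it has the evident derivative [f t - f (t - h)]. *)
Definition sliding h f t := primitive f t - primitive f (t - h).

Lemma is_derive_sliding h M f (x : R) : continuous f -> vanishes_off M f ->
  is_derive x 1 (sliding h f) (f x - f (x - h)).
Proof.
move=> cf f0; apply: is_deriveB; first exact: is_derive_primitive cf f0.
have D2 : is_derive x 1 (fun t => 1 * t - h) 1 by exact: is_derive_affine.
have := @is_derive1_comp R (primitive f) (fun t => 1 * t - h) x (f (x - h)) 1.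
rewrite mulr1 mul1r => D; have := D (is_derive_primitive _ cf f0) D2.
by under eq_fun do rewrite mul1r.
Qed.

Lemma slidingE h M f t : 0 < h -> continuous f -> vanishes_off M f ->
  (\int[leb]_(s in `[0%R, h]) (f (t - s)%R)%:E)%E = (sliding h f t)%:E.
Proof.
move=> h0 cf f0.
pose G s := - primitive f (t - s).
have DG (s : R) : is_derive s 1 G (f (t - s)).
  have D2 : is_derive s 1 (fun s => -1 * s + t) (-1) by exact: is_derive_affine.
  have := @is_derive1_comp R (primitive f) (fun s => -1 * s + t) s (f (-1 * s + t)) (-1).
  move=> D; have := is_deriveN (D (is_derive_primitive _ cf f0) D2).
  rewrite mulrN1 opprK mulN1r addrC /G.
  by under eq_fun do rewrite /= mulN1r addrC.
rewrite (@continuous_FTC2 _ (fun s => f (t - s)) G)//.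
- by rewrite /G subr0 -EFinB; congr (_%:E); rewrite opprK addrC.
- apply: continuous_subspaceT => s.
  apply: (@continuous_comp _ _ _ (fun s => t - s) f); last exact: cf.
  by apply: cvgB; [exact: cvg_cst|exact: cvg_id].
- have cG : continuous G.
    by move=> s; apply/differentiable_continuous/derivable1_diffP; case: (DG s).
  split; first by move=> s _; case: (DG s).
  + exact/cvg_at_right_filter/cG.
  + exact/cvg_at_left_filter/cG.
- by move=> s _; rewrite derive1E; case: (DG s).
Qed.

Lemma smooth1_sliding h M f : smooth1 f -> vanishes_off M f -> smooth1 (sliding h f).
Proof.
move=> sf f0; have cf := smooth1_continuous sf.
apply: derivable_smooth1.
  by move=> x; case: (is_derive_sliding h x cf f0).
rewrite (_ : derive1 _ = fun x => f x + (-1) * f (1 * x + - h)).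
  apply: smooth1D => //; apply: smooth1M; first exact: smooth1_cst.
  exact: smooth1_affine.
apply/funext => x; rewrite derive1E mulN1r mul1r.
by case: (is_derive_sliding h x cf f0).
Qed.

Lemma vanishes_off_sliding h M f : 0 < h -> continuous f -> vanishes_off M f ->
  vanishes_off (M + h) (sliding h f).
Proof.
move=> h0 cf f0 x hx; apply: EFin_inj; rewrite -(slidingE x h0 cf f0).
rewrite (eq_integral (cst 0%E)) ?integral0// => s; rewrite inE/= in_itv/= => /andP[s0 sh].
congr (_%:E); apply: f0.
by move: hx; rewrite !ltNge !ler_norml -!(rwP negP) => hx hs; apply: hx; lra.
Qed.

End bounded_support.

(** * Tensor products of one-variable functions as test functions *)

Section prod_fun.
Context {R : realType} (n : nat).
Implicit Types (F : 'I_n -> R -> R) (x : 'rV[R]_n).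

Definition prod_fun F x := \prod_i F i (x ord0 i).

Definition update F (i : 'I_n) (f : R -> R) j := if j == i then f else F j.

Lemma prod_fun_update F i f x :
  prod_fun (update F i f) x = f (x ord0 i) * \prod_(j | j != i) F j (x ord0 j).
Proof.
rewrite /prod_fun (bigD1 i)//= /update eqxx; congr (_ * _).
by apply: eq_bigr => j /negPf ->.
Qed.

Lemma update_id F i : update F i (F i) = F.
Proof. by apply/funext => j; rewrite /update; case: eqP => [->|]. Qed.

Lemma coord_delta (h : R) i x : (h *: delta_mx ord0 i + x) ord0 i = h + x ord0 i.
Proof. by rewrite !mxE !eqxx mulr1. Qed.

Lemma coord_delta_neq (h : R) i j x : j != i -> (h *: delta_mx ord0 i + x) ord0 j = x ord0 j.
Proof. by move=> ji; rewrite !mxE (negPf ji) andbF mulr0 add0r. Qed.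

Lemma prod_fun_delta F (h : R) i x :
  prod_fun F (h *: delta_mx ord0 i + x) = F i (h + x ord0 i) * \prod_(j | j != i) F j (x ord0 j).
Proof.
rewrite -[in LHS](update_id F i) prod_fun_update coord_delta; congr (_ * _).
by apply: eq_bigr => j ji; rewrite coord_delta_neq.
Qed.

Lemma is_derive_prod_fun F i x : derivable (F i) (x ord0 i) 1 ->
  is_derive x (delta_mx ord0 i) (prod_fun F) (prod_fun (update F i (derive1 (F i))) x).
Proof.
move=> dF.
have h : (fun h => h^-1 *: ((prod_fun F \o shift x) (h *: delta_mx ord0 i) - prod_fun F x)) @ 0^' -->
    prod_fun (update F i (derive1 (F i))) x.
  rewrite prod_fun_update; set K := \prod_(_ | _) _.
  rewrite (_ : (fun h => _) = fun h => (h^-1 *: ((F i \o shift (x ord0 i)) (h *: 1) - F i (x ord0 i))) * K).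
    apply: cvgM; last exact: cvg_cst.
    by rewrite derive1E; exact: dF.
  apply/funext => h; rewrite /= prod_fun_delta -/K -[in X in _ - X](update_id F i) prod_fun_update -/K.
  by rewrite [h *: 1]mulr1 -mulrBl scalerAl.
apply: DeriveDef; first by apply/cvg_ex; eexists; exact: h.
exact: cvg_lim h.
Qed.

Lemma continuous_prod_fun F : (forall i, continuous (F i)) -> continuous (prod_fun F).
Proof.
move=> cF; rewrite /prod_fun.
have mulc : continuous (fun x : R * R => x.1 * x.2) by exact: mul_continuous.
have cFi i : continuous (fun x : 'rV[R]_n => F i (x ord0 i)).
  move=> x; apply: (@continuous_comp _ _ _ (fun y : 'rV[R]_n => y ord0 i) (F i)); last exact: cF.
  exact: coord_continuous.
have := @continuous_big R 'I_n *%R 1 xpredT mulc _ (index_enum 'I_n) (fun i (x : 'rV[R]_n) => F i (x ord0 i)).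
by apply.
Qed.

(** A partial derivative only replaces one factor by its derivative, so products of smooth factors
    are stable under differentiation; smoothness then reduces to continuity and derivability of such
    products. *)
Lemma iter_partial_prod_fun F s : (forall i, smooth1 (F i)) ->
  exists2 G, (forall i, smooth1 (G i)) & iter_partial s (prod_fun F) = prod_fun G.
Proof.
move=> sF; elim: s => [|i s [G sG IH]] /=; first by exists F.
exists (update G i (derive1 (G i))).
  by move=> j; rewrite /update; case: ifP => // _; exact: smooth1_derive1.
apply/funext => x; rewrite IH /partial.
have D : is_derive x (delta_mx ord0 i) (prod_fun G) _ :=
  is_derive_prod_fun (@smooth1_derivable _ _ _ (sG i)).
by rewrite (derive_val (is_derive := D)).
Qed.

Lemma test_function_prod_fun F M : (forall i, smooth1 (F i)) ->
  (forall i, vanishes_off M (F i)) -> test_function (prod_fun F).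
Proof.
move=> sF F0; split=> [s|].
  have [G sG ->] := iter_partial_prod_fun s sF; split.
    by apply: continuous_prod_fun => i; exact: smooth1_continuous.
  by move=> i x; case: (is_derive_prod_fun (@smooth1_derivable _ _ (x ord0 i) (sG i))).
pose K := [set v : 'rV[R]_n | forall i, v ord0 i \in `[- M, M]].
have cK : compact K.
  by apply: (@rV_compact _ _ (fun=> `[- M, M]%classic)) => _; exact: segment_compact.
apply: (subclosed_compact _ cK); first exact: closed_closure.
have -> : K = closure K by apply/closure_id; apply: compact_closed => //; exact: norm_hausdorff.
apply: closureS => x /= /prodf_neq0 h.
by move=> i; have := h i (erefl _); rewrite in_itv/= -ler_norml leNgt; apply: contra => ?; rewrite F0.
Qed.

End prod_fun.

(** * The fundamental lemma *)

Section fundamental_lemma.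
Context {R : realType} (n : nat).
Implicit Types (a b x : 'rV[R]_n) (f phi : 'rV[R]_n -> R).
Local Notation mu := (@lebesgue_rV R n).

(** Half-open boxes stand in for compact sets here because [ae_eq0_box] runs on them. *)
Definition box_integrable f := forall a b, mu.-integrable (box a b) (EFin \o f).

Lemma measurable_fun_cst_mul_indic (c : R) f (A : set 'rV[R]_n) : measurable A ->
  measurable_fun setT f -> measurable_fun setT (fun x => c * f x * \1_A x).
Proof.
move=> mA mf; apply: measurable_funM; last exact: measurable_indic.
by apply: measurable_funM => //; exact: measurable_cst.
Qed.

Lemma box_integrable_cst_mul_indic (c : R) f a b : measurable_fun setT f -> box_integrable f ->
  mu.-integrable setT (fun x => (c * f x * \1_(box a b) x)%:E).
Proof.
move=> mf fi.
have h := integrableZl (measurable_box a b) c (fi a b).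
move/(integrable_mkcond _ (measurable_box a b)) : h.
apply: eq_integrable => // x _; rewrite patchE indicE.
by case: ifPn => _; rewrite ?mulr1 ?mulr0.
Qed.

Lemma box_integrable_mul f phi a b (c : R) : measurable_fun setT f -> box_integrable f ->
  measurable_fun setT phi -> (forall x, `|phi x| <= c) -> (forall x, ~ box a b x -> phi x = 0) ->
  mu.-integrable setT (fun x => (f x * phi x)%:E).
Proof.
move=> mf fi mphi phic phi0.
apply: le_integrable (box_integrable_cst_mul_indic c a b mf fi) => //.
  by apply/measurable_EFinP; exact: measurable_funM.
move=> x _; rewrite /= lee_fin !normrM indicE.
have c0 : 0 <= c by exact: le_trans (normr_ge0 _) (phic x).
have [xB|xB] := pselect (box a b x).
  by rewrite mem_set//= normr1 mulr1 mulrC ler_wpM2r// (le_trans (phic x))// ler_norm.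
by rewrite phi0// normr0 mulr0 mulr_ge0.
Qed.

Lemma locally_integrable_box f : locally_integrable_rV f -> box_integrable f.
Proof.
move=> [mf fi] a b.
pose K := [set v : 'rV[R]_n | forall i, v ord0 i \in `[a ord0 i, b ord0 i]].
have cK : compact K.
  by apply: (@rV_compact _ _ (fun i => `[a ord0 i, b ord0 i]%classic)) => i; exact: segment_compact.
have clK : closed K by apply: compact_closed => //; exact: norm_hausdorff.
have mK : measurable K.
  rewrite -(setCK K); apply: measurableC; apply: open_measurable_rV.
  exact: closed_openC.
apply: (@integrableS _ _ _ mu K) => //; first exact: measurable_box.
  by move=> x xB i; have := xB i; rewrite !in_itv/= => /andP[/ltW -> ->].
apply/integrableP; split; last exact: fi.
by apply/measurable_EFinP; exact: measurable_funTS.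
Qed.

Definition box_bump (k : nat) a b : 'rV[R]_n -> R :=
  prod_fun (fun i => bump k (a ord0 i) (b ord0 i)).

Lemma box_bump_ge0 k a b x : 0 <= box_bump k a b x.
Proof. by rewrite prodr_ge0// => i _; exact: bump_ge0. Qed.

Lemma box_bump_le1 k a b x : `|box_bump k a b x| <= 1.
Proof.
rewrite ger0_norm ?box_bump_ge0//; apply: prodr_ile1 => i _.
by rewrite bump_ge0 bump_le1.
Qed.

Lemma box_bump_out k a b x : ~ box a (b + const_mx 1) x -> box_bump k a b x = 0.
Proof.
move=> /existsNP[i xi]; apply/eqP; rewrite prodf_seq_eq0; apply/hasP; exists i.
  by rewrite mem_index_enum.
rewrite /= bump_out//; apply/negP => hx; apply: xi; move: hx.
by rewrite !mxE in_itv/= => /andP[-> /ltW].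
Qed.

Lemma bump_vanishes_off k (c d : R) : vanishes_off (`|c| + `|d| + 1) (bump k c d).
Proof.
move=> x xM; rewrite bump_out//; apply/negP => /andP[cx xd].
move: xM; apply/negP; rewrite -leNgt ler_norml.
have := ler_norm d; have := ler_norm (- c); have := normr_ge0 c; have := normr_ge0 d.
by rewrite normrN => *; apply/andP; split; lra.
Qed.

Lemma box_bump_vanishes_off k a b i :
  vanishes_off (\sum_j (`|a ord0 j| + `|b ord0 j|) + 1) (bump k (a ord0 i) (b ord0 i)).
Proof.
move=> x xM; apply: (@bump_vanishes_off k); apply: le_lt_trans xM.
by rewrite lerD2r (bigD1 i)//= lerDl sumr_ge0// => j _; rewrite addr_ge0.
Qed.

Lemma test_function_box_bump k a b : test_function (box_bump k a b).
Proof.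
apply: (@test_function_prod_fun _ _ _ (\sum_j (`|a ord0 j| + `|b ord0 j|) + 1)) => i.
  exact: smooth1_bump.
exact: box_bump_vanishes_off.
Qed.

Lemma box_bump_cvg a b x : (fun k => box_bump k a b x) @ \oo --> (\1_(box a b) x : R).
Proof.
have -> : \1_(box a b) x = \prod_i ((a ord0 i < x ord0 i <= b ord0 i)%R%:R : R).
  rewrite indicE; have [xB|xB] := pselect (box a b x).
    by rewrite mem_set//= big1// => i _; have := xB i; rewrite in_itv/= => ->.
  rewrite memNset//=; apply/esym/eqP; rewrite prodf_seq_eq0; apply/hasP.
  move/existsNP : xB => [i xi]; exists i; first by rewrite mem_index_enum.
  by move: xi; rewrite in_itv/= => /negP/negPf ->.
have mulc : continuous (fun y : R * R => y.1 * y.2) by exact: mul_continuous.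
have := @cvg_big R 'I_n *%R 1 xpredT mulc _ _ (index_enum 'I_n)
  (fun i k => bump k (a ord0 i) (b ord0 i) (x ord0 i))
  (fun i => (a ord0 i < x ord0 i <= b ord0 i)%R%:R) eventually_filter.
by apply => i _; exact: bump_cvg.
Qed.

Lemma measurable_test_function phi : test_function phi -> measurable_fun setT phi.
Proof. by move=> [/(_ [::])[cphi _] _]; exact: continuous_measurable_rV. Qed.

(** The bumps converge to the indicator of the box and are supported in one larger box, so dominated
    convergence gives zero integral over every box, and [ae_eq0_box] concludes. *)
Lemma fundamental_lemma f : measurable_fun setT f -> box_integrable f ->
  (forall k a b, (\int[mu]_x (f x * box_bump k a b x)%:E = 0)%E) ->
  {ae mu, forall x, f x = 0}.
Proof.
move=> mf fi f0; apply: ae_eq0_box => // a b.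
have mb k c d : measurable_fun setT (box_bump k c d).
  by apply: measurable_test_function; exact: test_function_box_bump.
pose B := box a (b + const_mx 1).
have [|||||_ _] := @dominated_convergence _ _ _ mu setT measurableT
  (fun k x => (f x * box_bump k a b x)%:E) (fun x => (f x * \1_(box a b) x)%:E)
  (fun x => `|1 * f x * \1_B x|%:E).
- by move=> k; apply/measurable_EFinP; exact: measurable_funM.
- apply/measurable_EFinP; apply: measurable_funM => //.
  by apply: measurable_indic; exact: measurable_box.
- apply: aeW => x _; apply/cvg_EFin; first exact: nearW.
  by apply: cvgM; [exact: cvg_cst|exact: box_bump_cvg].
- by apply: integrable_norm; exact: box_integrable_cst_mul_indic.
- apply: aeW => x k _; rewrite /= lee_fin !normrM normr1 mul1r.
  rewrite ler_wpM2l// indicE; have [xB|xB] := pselect (B x).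
    by rewrite mem_set//= normr1 box_bump_le1.
  by rewrite box_bump_out// normr0.
- rewrite (_ : [sequence _]_k = cst 0%E); last by apply/funext => k; exact: f0.
  move=> h; rewrite integral_mkcond.
  have /= := cvg_unique _ h (cvg_cst 0%E).
  move=> /(_ (@ereal_hausdorff R)) <-; apply: eq_integral => x _; rewrite patchE indicE.
  by case: ifP => _; rewrite ?mulr1 ?mulr0.
Qed.
End fundamental_lemma.

(** * Translations and weak gradients *)

Section slide.
Context {R : realType} (n : nat).
Implicit Types (a b x : 'rV[R]_n) (f gamma phi : 'rV[R]_n -> R).
Local Notation mu := (@lebesgue_rV R n).
Local Notation leb := (@lebesgue_measure R).
Variables (i : 'I_n) (h : R).
Hypothesis h0 : 0 < h.
Local Notation e := (delta_mx ord0 i : 'rV[R]_n).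
Local Notation I := (`[0, h]%classic : set R).

Lemma measurable_slide (c : R) :
  measurable_fun setT (fun p : 'rV[R]_n * measurableTypeR R => p.1 + (c * p.2) *: e).
Proof.
apply/measurable_fun_rVP => j; under eq_fun do rewrite !mxE.
apply: measurable_funD; first exact: (measurableT_comp (measurable_coord j) measurable_fst).
apply: measurable_funM; last exact: measurable_cst.
by apply: measurable_funM; [exact: measurable_cst|exact: measurable_snd].
Qed.

(** By Tonelli: the norms of the slices at fixed [s] are bounded by one finite [C], and [s] ranges
    over a bounded interval. *)
Lemma slide_integrable (K : 'rV[R]_n * measurableTypeR R -> R) (C : \bar R) :
  measurable_fun setT K -> (C < +oo)%E ->
  (forall s, s \in I -> (\int[mu]_x `|(K (x, s))%:E| <= C)%E) ->
  (forall x s, s \notin I -> K (x, s) = 0) ->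
  (mu \x leb)%E.-integrable setT (EFin \o K).
Proof.
move=> mK Coo KC K0; apply/integrable21ltyP; first exact/measurable_EFinP.
have C0 : (0 <= C)%E.
  by apply: le_trans (KC 0 _); [exact: integral_ge0|rewrite inE/= in_itv/= lexx ltW].
apply: (@le_lt_trans _ _ (\int[leb]_s (C * (\1_I s)%:E))%E).
{ apply: ge0_le_integral => //.
  - by move=> s _; exact: integral_ge0.
  - apply: (@measurable_fun_fubini_tonelli_G _ _ _ _ _ mu (abse \o (EFin \o K))).
    + by apply: measurableT_comp => //; exact/measurable_EFinP.
    + by move=> p /=.
  - apply: emeasurable_funM; first exact: measurable_cst.
    by apply/measurable_EFinP; exact: measurable_indic.
  - move=> s _; rewrite indicE; have [sI|sI] := boolP (s \in I).
      by rewrite mule1; exact: KC.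
    by rewrite mule0 integral0_eq// => x _; rewrite /= K0// normr0.
}
have [r r0 rE] : exists2 r : R, (0 <= r)%R & C = r%:E.
  by exists (fine C); [exact: fine_ge0|rewrite fineK// ge0_fin_numE].
rewrite rE ge0_integralZl_EFin//; last by apply/measurable_EFinP; exact: measurable_indic.
rewrite integral_indic// setIT lte_mul_pinfty//.
by rewrite /= lebesgue_measure_itv/=; case: ifP => _; rewrite ltry.
Qed.

Variables (gamma phi : 'rV[R]_n -> R) (a b : 'rV[R]_n).
Hypotheses (mgamma : measurable_fun setT gamma) (igamma : box_integrable gamma).
Hypotheses (mphi : measurable_fun setT phi) (phi1 : forall x, `|phi x| <= 1).
Hypothesis phi0 : forall x, ~ box a b x -> phi x = 0.

(** Contains every translate of [box a b] by [s *: e] with [0 <= s <= h], so one integrable function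
    dominates all slices. *)
Let B := box a (b + const_mx h).
Let C := (\int[mu]_x `|(1 * gamma x * \1_B x)%:E|)%E.

Let Coo : (C < +oo)%E.
Proof.
by have /integrableP[] := box_integrable_cst_mul_indic 1 a (b + const_mx h) mgamma igamma.
Qed.

Let mg : measurable_fun setT (fun x => 1 * gamma x * \1_B x).
Proof. by apply: measurable_fun_cst_mul_indic => //; exact: measurable_box. Qed.

Let dominated s x : s \in I -> `|gamma x * phi (x - s *: e)| <= `|1 * gamma x * \1_B x|.
Proof.
rewrite inE/= in_itv/= => /andP[s0 sh]; rewrite mul1r !normrM ler_wpM2l//.
have [xB|xB] := pselect (box a b (x - s *: e)); last by rewrite phi0// normr0.
rewrite indicE mem_set ?normr1// => j; have := xB j; rewrite !mxE !in_itv/= ?eqxx/=.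
have : 0 <= s * (j == i)%:R <= h.
  by case: eqP => _; rewrite ?mulr1 ?mulr0 ?lexx ?s0 ?sh// ltW.
lra.
Qed.

(** Integrated over [s] and [x], this pairs the integral of [gamma] along a segment with [phi]. In
    [unslide_kernel] the translation has been moved from [gamma] to [phi]. *)
Definition slide_kernel (p : 'rV[R]_n * measurableTypeR R) :=
  gamma (p.1 + p.2 *: e) * phi p.1 * \1_I p.2.

Definition unslide_kernel (p : 'rV[R]_n * measurableTypeR R) :=
  gamma p.1 * phi (p.1 - p.2 *: e) * \1_I p.2.

Lemma measurable_slide_kernel : measurable_fun setT slide_kernel.
Proof.
apply: measurable_funM; last first.
  by apply: measurableT_comp; [exact: measurable_indic|exact: measurable_snd].
apply: measurable_funM; last exact: (measurableT_comp mphi measurable_fst).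
have := measurableT_comp mgamma (measurable_slide 1).
by under eq_fun do rewrite mul1r.
Qed.

Lemma measurable_unslide_kernel : measurable_fun setT unslide_kernel.
Proof.
apply: measurable_funM; last first.
  by apply: measurableT_comp; [exact: measurable_indic|exact: measurable_snd].
apply: measurable_funM; first exact: (measurableT_comp mgamma measurable_fst).
have := measurableT_comp mphi (measurable_slide (-1)).
by under eq_fun do rewrite mulN1r scaleNr.
Qed.

Let unslide_kernel_shift s x : slide_kernel (x, s) = unslide_kernel (x + s *: e, s).
Proof. by rewrite /slide_kernel /unslide_kernel/= addrK. Qed.

Let measurable_unslide_kernel1 s : measurable_fun setT (fun x => (unslide_kernel (x, s))%:E).
Proof.
apply/measurable_EFinP; apply: (measurableT_comp measurable_unslide_kernel).
exact: pair2_measurable.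
Qed.

Let unslide_kernel_le s : s \in I -> (\int[mu]_x `|(unslide_kernel (x, s))%:E| <= C)%E.
Proof.
move=> sI; apply: ge0_le_integral => //.
- by apply: measurableT_comp => //; exact: measurable_unslide_kernel1.
- by apply: measurableT_comp => //; exact/measurable_EFinP.
- by move=> x _; rewrite lee_fin /unslide_kernel/= indicE sI mulr1 dominated.
Qed.

Lemma integrable_unslide_kernel : (mu \x leb)%E.-integrable setT (EFin \o unslide_kernel).
Proof.
apply: (slide_integrable measurable_unslide_kernel Coo) => // x s sI.
by rewrite /unslide_kernel /= indicE (negPf sI) mulr0.
Qed.

Lemma integrable_slide_kernel : (mu \x leb)%E.-integrable setT (EFin \o slide_kernel).
Proof.
apply: (slide_integrable measurable_slide_kernel Coo) => [s sI|x s sI]; last first.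
  by rewrite /slide_kernel /= indicE (negPf sI) mulr0.
under eq_integral do rewrite unslide_kernel_shift.
rewrite (ge0_integral_shift (s *: e) (f := fun x => `|(unslide_kernel (x, s))%:E|%E)) => [|//|].
- exact: unslide_kernel_le.
- by apply: measurableT_comp => //; exact: measurable_unslide_kernel1.
- by move=> x; exact: abse_ge0.
Qed.

(** At fixed [s] the two kernels differ by the translation by [s *: e], so their integrals in [x]
    agree. *)
Lemma slide_Fubini : (\int[mu]_x \int[leb]_s (unslide_kernel (x, s))%:E =
  \int[mu]_x \int[leb]_s (slide_kernel (x, s))%:E)%E.
Proof.
rewrite (Fubini integrable_unslide_kernel) (Fubini integrable_slide_kernel)/=.
apply: eq_integral => s _.
under [RHS]eq_integral do rewrite unslide_kernel_shift.
by rewrite (integral_shift (s *: e) (f := fun x => (unslide_kernel (x, s))%:E)).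
Qed.

End slide.

Section weak_slide.
Context {R : realType} (n : nat).
Implicit Types (a b x : 'rV[R]_n) (phi : 'rV[R]_n -> R).
Local Notation mu := (@lebesgue_rV R n).
Local Notation leb := (@lebesgue_measure R).
Variables (i : 'I_n) (h : R).
Hypothesis h0 : 0 < h.
Local Notation e := (delta_mx ord0 i : 'rV[R]_n).
Local Notation I := (`[0, h]%classic : set R).
Variables (gamma : 'rV[R]_n -> R).
Hypotheses (mgamma : measurable_fun setT gamma) (igamma : box_integrable gamma).

Let J x : \bar R := (\int[leb]_s (gamma (x + s *: e) * \1_I s)%:E)%E.

(** Where [J x] is infinite, [fine] returns 0. Such points are harmless: finiteness matters only
    where a test function is nonzero, and Fubini gives it there almost everywhere. *)
Definition line_integral x : R := fine (J x).

Let mkernel : measurable_fun setT (fun p : 'rV[R]_n * measurableTypeR R =>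
  (gamma (p.1 + p.2 *: e) * \1_I p.2)%:E).
Proof.
have := @measurable_slide_kernel _ _ i h gamma (cst 1) mgamma (measurable_cst _).
by move=> /measurable_EFinP; rewrite /slide_kernel; under eq_fun do rewrite mulr1.
Qed.

Let mJ : measurable_fun setT J.
Proof.
(* Tonelli measurability concerns nonnegative integrands, hence the splitting into positive and
   negative parts. *)
rewrite (_ : J = fun x =>
  (\int[leb]_s ((fun p : 'rV[R]_n * measurableTypeR R =>
     (gamma (p.1 + p.2 *: e) * \1_I p.2)%:E)^\+ (x, s))
  - \int[leb]_s ((fun p : 'rV[R]_n * measurableTypeR R =>
     (gamma (p.1 + p.2 *: e) * \1_I p.2)%:E)^\- (x, s)))%E); last first.
  apply/funext => x; rewrite /J integralE; congr (_ - _)%E;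
  by apply: eq_integral => s _; rewrite !(funeposE, funenegE).
apply: emeasurable_funB.
  by apply: measurable_fun_fubini_tonelli_F => //; exact: measurable_funepos.
by apply: measurable_fun_fubini_tonelli_F => //; exact: measurable_funeneg.
Qed.

Lemma measurable_line_integral : measurable_fun setT line_integral.
Proof. exact: measurableT_comp. Qed.

(** Taking the indicator of the box for [phi] turns the inner integral of [slide_kernel] into [J] on
    the box, so Fubini yields its integrability. *)
Lemma line_integral_box : box_integrable line_integral.
Proof.
move=> a b; have mB := measurable_box a b.
have m1 : measurable_fun setT (\1_(box a b) : 'rV[R]_n -> R) by exact: measurable_indic.
have K : (mu \x leb)%E.-integrable setT (EFin \o slide_kernel i h gamma (\1_(box a b))).
  apply: (@integrable_slide_kernel _ _ i h h0 gamma _ a b) => // x.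
    by rewrite indicE; case: (_ \in _); rewrite ?normr1 ?normr0.
  by move=> xB; rewrite indicE memNset.
have iF := integrable_fubini_F K.
suff : mu.-integrable setT ((EFin \o line_integral) \_ (box a b)).
  by move/(integrable_mkcond _ mB).
apply: le_integrable iF => //.
  apply/(measurable_restrictT _ mB); apply/measurable_EFinP.
  by apply: measurable_funTS; exact: measurable_line_integral.
move=> x _; rewrite patchE /fubini_F; case: ifPn => [xB|_]; last by rewrite abse0 abse_ge0.
rewrite (_ : (\int[leb]_y _)%E = J x); last first.
  by apply: eq_integral => s _; rewrite /slide_kernel/= indicE xB mulr1.
by rewrite /= /line_integral; case: (J x) => [r||]//=; rewrite ?normr0 ?leey.
Qed.

Lemma line_integralM phi a b : measurable_fun setT phi -> (forall x, `|phi x| <= 1) ->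
  (forall x, ~ box a b x -> phi x = 0) ->
  (\int[mu]_x (line_integral x * phi x)%:E =
   \int[mu]_x \int[leb]_s (slide_kernel i h gamma phi (x, s))%:E)%E.
Proof.
move=> mphi phi1 phi0.
have K := integrable_slide_kernel i h0 mgamma igamma mphi phi1 phi0.
apply: ae_eq_integral => //.
- apply/measurable_EFinP; apply: measurable_funM => //; exact: measurable_line_integral.
- exact: measurable_fubini_F K.
- have := ae_integrable1 K; apply: filterS => x /= ix _.
(* Where [phi x = 0] both sides vanish whatever [J x] is; elsewhere division by [phi x] shows that
   [gamma] is integrable along the segment. *)
have [px|px] := eqVneq (phi x) 0.
  rewrite px mulr0 integral0_eq// => s _.
  by rewrite /slide_kernel/= px mulr0 mul0r.
have ig : leb.-integrable setT (fun s => (gamma (x + s *: e) * \1_I s)%:E).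
  have := integrableZl measurableT (phi x)^-1 ix.
  apply: eq_integrable => // s _; rewrite /= /slide_kernel/=.
  by rewrite -EFinM; congr (_%:E); field.
have Jfin : J x \is a fin_num by exact: integrable_fin_num.
rewrite EFinM /line_integral fineK// muleC -integralZl//.
apply: eq_integral => s _; rewrite /slide_kernel/= -EFinM; congr (_%:E); ring.
Qed.

(** A translation along [e] affects only the [i]-th factor, which the integration in [s] turns into
    its sliding integral. The product obtained is again a test function, to which the weak gradient
    can be applied. *)
Lemma unslide_kernel_prod_fun (F : 'I_n -> R -> R) (M : R) x :
  continuous (F i) -> vanishes_off M (F i) ->
  (\int[leb]_s (unslide_kernel i h gamma (prod_fun F) (x, s))%:E =
   (gamma x * prod_fun (update F i (sliding h (F i))) x)%:E)%E.
Proof.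
move=> cF F0; rewrite prod_fun_update; set P := \prod_(_ | _) _.
rewrite mulrCA EFinM muleC -(slidingE _ h0 cF F0).
transitivity (\int[leb]_(s in I) ((gamma x * P)%:E * (F i (x ord0 i - s))%:E))%E.
  rewrite [RHS]integral_mkcond; apply: eq_integral => s _.
  rewrite patchE /unslide_kernel /= indicE; case: ifP => _; rewrite ?mulr0// mulr1.
  rewrite -scaleNr addrC prod_fun_delta -/P -EFinM (addrC (- s)); congr (_%:E); ring.
rewrite integralZl//.
apply: continuous_compact_integrable; first exact: segment_compact.
apply: continuous_subspaceT => s.
apply: (@continuous_comp _ _ _ (fun s => x ord0 i - s) (F i)); last exact: cF.
by apply: cvgB; [exact: cvg_cst|exact: cvg_id].
Qed.

Lemma abs_line_integral_le x :
  (`|line_integral x|%:E <= \int[leb]_(s in I) `|gamma (x + s *: e)|%:E)%E.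
Proof.
rewrite [leRHS]integral_mkcond (_ : (\int[leb]_s _)%E =
   (\int[leb]_s `|(gamma (x + s *: e) * \1_I s)%:E|)%E); last first.
  apply: eq_integral => s _; rewrite patchE indicE /= normrM.
  by case: ifP => _; rewrite ?normr1 ?mulr1// normr0 mulr0.
apply: (@le_trans _ _ `|J x|%E).
  by rewrite /line_integral; case: (J x) => [r||]//=; rewrite ?normr0 ?leey.
apply: le_abse_integral => //.
exact: (measurableT_comp mkernel (pair1_measurable x)).
Qed.
End weak_slide.

Section weak_gradient_slide.
Context {R : realType} (n : nat).
Local Notation mu := (@lebesgue_rV R n).
Local Notation leb := (@lebesgue_measure R).
Variables (u : 'rV[R]_n -> R) (g : 'rV[R]_n -> 'rV[R]_n).
Hypothesis ug : is_weak_gradient u g.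

Let mu_ : measurable_fun setT u. Proof. by have [[]] := ug. Qed.
Let iu : box_integrable u.
Proof. by have [? _ _] := ug; exact: locally_integrable_box. Qed.
Let mg i : measurable_fun setT (fun x => g x ord0 i).
Proof. by have [_ /(_ i)[]] := ug. Qed.
Let ig i : box_integrable (fun x => g x ord0 i).
Proof. by have [_ /(_ i)? _] := ug; exact: locally_integrable_box. Qed.

Lemma box_integrable_shift (v : 'rV[R]_n) : box_integrable (fun x => u (x + v)).
Proof.
move=> a b; apply/(integrable_mkcond _ (measurable_box _ _)).
have := integrable_shift v ((integrable_mkcond _ (measurable_box _ _)).1 (iu (a + v) (b + v))).
apply: eq_integrable => // x _; rewrite !patchE.
suff -> : (x + v \in box (a + v) (b + v)) = (x \in box a b) by [].
by apply/idP/idP => /set_mem h; apply/mem_set => j; have := h j; rewrite !mxE !in_itv/= ltrD2r lerD2r.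
Qed.

(* Tests the weak gradient against [Psi x = \int_0^h phi (x - s e_i) ds], whose
   [i]-th partial derivative is [phi x - phi (x - h e_i)]. *)
Lemma weak_gradient_line_integral (i : 'I_n) (h : R) : 0 < h ->
  {ae mu, forall x : 'rV[R]_n, u (x + h *: delta_mx ord0 i) - u x = line_integral i h (fun x => g x ord0 i) x}.
Proof.
move=> h0; pose e : 'rV[R]_n := delta_mx ord0 i.
pose w := line_integral i h (fun x => g x ord0 i).
have mw : measurable_fun setT w := measurable_line_integral i h (mg i).
have iw : box_integrable w := line_integral_box i h0 (mg i) (ig i).
have mus : measurable_fun setT (fun x : 'rV[R]_n => u (x + h *: e)).
  exact: (measurableT_comp mu_ (measurable_shift _)).
have ius := box_integrable_shift (h *: e).
suff : {ae mu, forall x : 'rV[R]_n, (u (x + h *: e) - u x) - w x = 0}.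
  by apply: filterS => x /eqP; rewrite subr_eq0 => /eqP.
apply: fundamental_lemma.
- by apply: measurable_funB => //; apply: measurable_funB.
- move=> a b; have mB := measurable_box a b.
  have := integrableB mB (integrableB mB (ius a b) (iu a b)) (iw a b).
  by apply: eq_integrable.
- move=> k a b.
  set phi := box_bump k a b.
  pose F j := bump k (a ord0 j) (b ord0 j).
  have sF j : smooth1 (F j) by exact: smooth1_bump.
  pose M := \sum_j (`|a ord0 j| + `|b ord0 j|) + 1.
  have F0 j : vanishes_off M (F j) by exact: box_bump_vanishes_off.
  have cFi : continuous (F i) by exact: smooth1_continuous.
  pose Psi := prod_fun (update F i (sliding h (F i))).
  have tPsi : test_function Psi.
  {
    apply: (@test_function_prod_fun _ _ _ (M + h)) => j; rewrite /update; case: ifP => _ //.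
    + exact: smooth1_sliding (sF i) (F0 i).
    + exact: vanishes_off_sliding h0 cFi (F0 i).
    + by move=> x hx; apply: F0; apply: lt_trans hx; rewrite ltrDl.
  }
  have mphi : measurable_fun setT phi.
    by apply: measurable_test_function; exact: test_function_box_bump.
  have dPsi (x : 'rV[R]_n) : partial i Psi x = phi x - phi (x - h *: e).
    rewrite /partial /Psi.
    have D := is_derive_sliding h (x ord0 i) cFi (F0 i).
    have dd : derivable (update F i (sliding h (F i)) i) (x ord0 i) 1.
      by rewrite /update eqxx; case: D.
    have D2 := is_derive_prod_fun dd.
    rewrite (derive_val (is_derive := D2)) prod_fun_update.
    rewrite {1}/update eqxx derive1E (derive_val (is_derive := D)).
    under eq_bigr => j ji do rewrite /update (negPf ji).
    have -> : x - h *: e = (- h) *: e + x by rewrite scaleNr addrC.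
    rewrite mulrBl /phi /box_bump prod_fun_delta; congr (_ - _); last first.
      by rewrite [- h + _]addrC.
    by rewrite /prod_fun [RHS](bigD1 i).
  have [_ _ /(_ _ tPsi i)] := ug.
  under eq_integral do rewrite dPsi mulrBr EFinB.
  have phi1 := box_bump_le1 k a b.
  have phi0 := @box_bump_out _ _ k a b.
  have iuphi := box_integrable_mul mu_ iu mphi phi1 phi0.
  have iusphi := box_integrable_mul mus ius mphi phi1 phi0.
  have iwphi := box_integrable_mul mw iw mphi phi1 phi0.
  have iuphis : mu.-integrable setT (fun x : 'rV[R]_n => (u x * phi (x - h *: e))%:E).
    have := integrable_shift (- (h *: e)) iusphi.
    by apply: eq_integrable => // x _; rewrite subrK.
  rewrite integralB//.
  rewrite -(integral_shift (h *: e) (f := fun x : 'rV[R]_n => (u x * phi (x - h *: e))%:E)); last exact: measurable_int iuphis.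
  under [X in (_ - X)%E]eq_integral do rewrite addrK.
  (* Since [Psi] is the integral of [phi (x - s e)] over [s], Fubini and translation carry the
     average from [Psi] over to the weak gradient. *)
  have -> : (\int[mu]_x (g x ord0 i * Psi x)%:E = \int[mu]_x (w x * phi x)%:E)%E.
    rewrite (line_integralM i h0 (mg i) (ig i) mphi phi1 phi0).
    rewrite -(slide_Fubini i h0 (mg i) (ig i) mphi phi1 phi0).
    by apply: eq_integral => x _; rewrite (unslide_kernel_prod_fun h0 _ _ cFi (F0 i)).
  have fu := integrable_fin_num measurableT iuphi.
  have fus := integrable_fin_num measurableT iusphi.
  have fw := integrable_fin_num measurableT iwphi.
  move=> eq1.
  under eq_integral do rewrite mulrBl EFinB mulrBl EFinB.
  rewrite integralB//; last exact: integrableB.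
  rewrite integralB//.
  rewrite -(fineK fu) -(fineK fus) -(fineK fw) -!EFinB -EFinN in eq1 *.
  by congr (_%:E); move: eq1 => [] ?; lra.
Qed.
End weak_gradient_slide.

(** * Translation estimates in L^q *)

Section translation_estimate.
Context {R : realType}.
Local Notation leb := (@lebesgue_measure R).

Lemma measurable_norm_powR d (T : measurableType d) (f : T -> R) (r : R) :
  measurable_fun setT f -> measurable_fun setT (fun x => (`|f x| `^ r)%:E).
Proof.
move=> mf; apply/measurable_EFinP.
apply: (measurableT_comp (measurable_powR r)).
exact: measurableT_comp.
Qed.

(** Hoelder against the indicator of [[0, h]], whose norm for the conjugate exponent [q'], raised to
    the power [q], is [h]^ (q / q') = h [^ (q - 1)]. *)
Lemma poweR_integral_le (h q : R) (f : R -> R) : 0 < h -> 1 < q -> measurable_fun setT f ->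
  ((\int[leb]_(s in `[0%R, h]) `|f s|%:E) `^ q <=
   (h `^ (q - 1))%:E * \int[leb]_(s in `[0%R, h]) (`|f s| `^ q)%:E)%E.
Proof.
move=> h0 q1 mf; pose I : set R := `[0, h]%classic.
have q0 : 0 < q by exact: lt_trans q1.
have qn0 : q != 0 by rewrite gt_eqF.
have qm0 : 0 < q - 1 by rewrite subr_gt0.
pose q' := q / (q - 1).
have q'0 : 0 < q' by exact: divr_gt0.
have conj : q^-1 + q'^-1 = 1 by rewrite /q' invf_div; field.
have mI0 : measurable (I : set (measurableTypeR R)) by exact: measurable_itv.
have mI : measurable_fun setT (\1_I : measurableTypeR R -> R).
  by apply: measurable_indic; exact: measurable_itv.
have mfI : measurable_fun setT (fun s => f s * \1_I s) by exact: measurable_funM.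
have := hoelder leb mfI mI q0 q'0 conj.
rewrite Lnorm1.
rewrite (_ : (\int[leb]_x _)%E = (\int[leb]_(s in I) `|f s|%:E)%E); last first.
  rewrite [RHS]integral_mkcond; apply: eq_integral => s _.
  rewrite patchE /= indicE; case: ifP => _; rewrite ?mulr1//.
  by rewrite !mulr0 normr0.
have A0 : (0 <= \int[leb]_(s in I) `|f s|%:E)%E by exact: integral_ge0.
move=> /(gt0_ler_poweR (ltW q0)).
rewrite !in_itv/= !leey !andbT => /(_ A0); rewrite mule_ge0 ?Lnorm_ge0// => /(_ isT).
move=> /le_trans; apply.
rewrite poweRM ?Lnorm_ge0// poweR_Lnorm// muleC.
have -> : ('N[leb]_q'%:E[EFin \o \1_I] `^ q)%E = (h `^ (q - 1))%:E.
  rewrite unlock -poweRrM.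
  rewrite (_ : (\int[leb]_x _)%E = h%:E).
    by rewrite poweR_EFin; congr ((_ `^ _)%:E); rewrite /q' invf_div; field; rewrite ?qn0 ?gt_eqF.
  transitivity (\int[leb]_s (\1_I s)%:E)%E.
    apply: eq_integral => s _; rewrite /= indicE.
    by case: (_ \in _); rewrite ?normr1 ?normr0 ?powR1 ?powR0// gt_eqF.
  rewrite integral_indic// setIT.
  by rewrite /= /I lebesgue_measure_itv/= lte_fin h0 oppr0 adde0.
apply: lee_wpmul2l; first by rewrite lee_fin powR_ge0.
rewrite [leRHS]integral_mkcond; apply: ge0_le_integral => //.
- by move=> s _; exact: poweR_ge0.
- exact: (@measurable_norm_powR _ _ (fun s : measurableTypeR R => f s * \1_I s) q mfI).
- apply/(measurable_restrictT _ mI0).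
  by apply: measurable_funTS; exact: measurable_norm_powR.
- move=> s _; rewrite patchE /= indicE; case: ifP => _; rewrite ?mulr1//.
  by rewrite mulr0 normr0 powR0.
Qed.

End translation_estimate.

Section translation_norm.
Context {R : realType} (n : nat).
Local Notation mu := (@lebesgue_rV R n).
Local Notation leb := (@lebesgue_measure R).
Variables (u : 'rV[R]_n -> R) (g : 'rV[R]_n -> 'rV[R]_n).
Hypothesis ug : is_weak_gradient u g.
Variables (q : R) (G : \bar R).
Hypothesis q1 : 1 < q.
Hypothesis hG : forall i, (\int[mu]_x (`|g x ord0 i| `^ q)%:E <= G)%E.

Let q0 : 0 < q. Proof. exact: lt_trans q1. Qed.
Let mu_ : measurable_fun setT u. Proof. by have [[]] := ug. Qed.
Let mg i : measurable_fun setT (fun x => g x ord0 i).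
Proof. by have [_ /(_ i)[]] := ug. Qed.

Definition translation_norm (v : 'rV[R]_n) : \bar R :=
  (\int[mu]_x (`|u (x + v) - u x| `^ q)%:E)%E.

Lemma measurable_increment (v : 'rV[R]_n) :
  measurable_fun setT (fun x : 'rV[R]_n => u (x + v) - u x).
Proof.
apply: measurable_funB => //.
exact: (measurableT_comp mu_ (measurable_shift v)).
Qed.

Lemma translation_norm_delta (i : 'I_n) (h : R) : 0 < h ->
  (translation_norm (h *: delta_mx ord0 i) <= (h `^ q)%:E * G)%E.
Proof.
move=> h0; pose e : 'rV[R]_n := delta_mx ord0 i.
pose gamma x := g x ord0 i.
pose I : set (measurableTypeR R) := `[0, h]%classic.
have mI : measurable I by exact: measurable_itv.
pose K (p : 'rV[R]_n * measurableTypeR R) := (`|gamma (p.1 + p.2 *: e) * \1_I p.2| `^ q)%:E.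
have mK : measurable_fun setT K.
  apply: measurable_norm_powR.
  have := @measurable_slide_kernel _ _ i h gamma (cst 1) (mg i) (measurable_cst _).
  by rewrite /slide_kernel; under eq_fun do rewrite mulr1.
have K0 p : (0 <= K p)%E by rewrite lee_fin powR_ge0.
have KE x : (\int[leb]_s K (x, s) = \int[leb]_(s in I) (`|gamma (x + s *: e)| `^ q)%:E)%E.
  rewrite [RHS]integral_mkcond; apply: eq_integral => s _.
  rewrite patchE /K /= indicE; case: ifP => _; rewrite ?mulr1//.
  by rewrite mulr0 normr0 powR0// gt_eqF.
have mKx : measurable_fun setT (fun x => \int[leb]_s K (x, s))%E.
  exact: measurable_fun_fubini_tonelli_F.
have step1 : (translation_norm (h *: e) <=
    \int[mu]_x ((h `^ (q - 1))%:E * \int[leb]_s K (x, s)))%E.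
{ apply: ae_ge0_le_integral => //.
  - exact: (@measurable_norm_powR _ _ _ _ q (measurable_increment _)).
  - by move=> x _; rewrite mule_ge0 ?lee_fin ?powR_ge0// integral_ge0.
  - by apply: emeasurable_funM => //; exact: measurable_cst.
  - have := weak_gradient_line_integral ug i h0; apply: filterS => x ux _.
    rewrite ux KE -poweR_EFin.
    apply: le_trans; last first.
      apply: poweR_integral_le => //.
      apply: (measurableT_comp (mg i)).
      have := measurableT_comp (@measurable_slide _ _ i 1) (pair1_measurable x).
      by rewrite /comp/=; under eq_fun do rewrite mul1r.
    apply: gt0_ler_poweR; first exact: ltW.
    + by rewrite in_itv/= lee_fin normr_ge0 leey.
    + by rewrite in_itv/= leey integral_ge0.
    + exact: abs_line_integral_le.
}
apply: (le_trans step1).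
rewrite ge0_integralZl_EFin//; [|by move=> x _; exact: integral_ge0|exact: powR_ge0].
rewrite (fubini_tonelli K)//.
have -> : (\int[leb]_s \int[mu]_x K (x, s) =
    \int[leb]_s ((\1_I s)%:E * \int[mu]_x (`|gamma x| `^ q)%:E))%E.
  apply: eq_integral => s _; rewrite indicE; have [sI|sI] := boolP (s \in I).
  { rewrite mul1e -[RHS](ge0_integral_shift (s *: e)).
    + by apply: eq_integral => x _; rewrite /K/= indicE sI mulr1.
    + exact: (@measurable_norm_powR _ _ _ _ q (mg i)).
    + by move=> x; rewrite lee_fin powR_ge0. }
  rewrite mul0e integral0_eq// => x _.
  by rewrite /K/= indicE (negPf sI) mulr0 normr0 powR0// gt_eqF.
rewrite ge0_integralZr//; [|by apply/measurable_EFinP; exact: measurable_indic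
  |by apply: integral_ge0 => x _; rewrite lee_fin powR_ge0].
rewrite integral_indic// setIT.
rewrite [X in (_ * (X * _))%E](_ : _ = h%:E); last first.
  by rewrite /= /I lebesgue_measure_itv/= lte_fin h0 oppr0 adde0.
rewrite muleA -EFinM mulrC mulr_powRB1 ?(ltW h0)//.
by apply: lee_wpmul2l; [rewrite lee_fin powR_ge0|exact: hG].
Qed.

Lemma powRD_le (a b : R) : 0 <= a -> 0 <= b -> (a + b) `^ q <= 2 `^ q * (a `^ q + b `^ q).
Proof.
move=> a0 b0; wlog ab : a b a0 b0 / a <= b.
  move=> H; have /orP[?|?] := le_total a b; first exact: H.
  by rewrite addrC (addrC (a `^ q)); exact: H.
apply: (@le_trans _ _ ((2 * b) `^ q)).
  by apply: ge0_ler_powR; rewrite ?nnegrE ?addr_ge0 ?mulr_ge0 ?(ltW q0)//; lra.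
by rewrite powRM// ler_wpM2l ?powR_ge0// lerDr powR_ge0.
Qed.

(** The increment by [v + w] telescopes through [u (x + w)], and the first part is an increment by
    [v] seen from [x + w], with the same integral by translation invariance. *)
Lemma translation_normD (v w : 'rV[R]_n) :
  (translation_norm (v + w) <= (2 `^ q)%:E * (translation_norm v + translation_norm w))%E.
Proof.
have mi v' := @measurable_norm_powR _ _ _ _ q (measurable_increment v').
have miw : measurable_fun setT (fun x : 'rV[R]_n => (`|u (x + w + v) - u (x + w)| `^ q)%:E).
  exact: (measurableT_comp (mi v) (measurable_shift w)).
rewrite {2}/translation_norm -(ge0_integral_shift w (mi v)); last by move=> x; rewrite lee_fin powR_ge0.
rewrite -ge0_integralD//; [|by move=> x _; rewrite lee_fin powR_ge0..].
have tac : forall x : 'rV[R]_n, setT x -> (0 <= (`|u (x + w + v) - u (x + w)| `^ q)%:E + (`|u (x + w) - u x| `^ q)%:E)%E.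
  by move=> x _; rewrite adde_ge0// lee_fin powR_ge0.
rewrite -ge0_integralZl_EFin//; last by apply: emeasurable_funD.
apply: ge0_le_integral => //.
- by apply: emeasurable_funM; [exact: measurable_cst|exact: emeasurable_funD].
- move=> x _; rewrite -EFinD -EFinM lee_fin.
  apply: le_trans (powRD_le (normr_ge0 _) (normr_ge0 _)).
  apply: ge0_ler_powR; rewrite ?nnegrE ?addr_ge0 ?(ltW q0)//.
  apply: le_trans (ler_normD _ _).
  by rewrite -(addrA x w v) (addrC w v) [X in _ <= `|X|]addrA subrK.
Qed.

(** The cost of reaching a vector by [k] successive moves along coordinate axes, each paying the
    factor of [translation_normD]. *)
Fixpoint translation_cst (k : nat) : R :=
  if k is k'.+1 then 2 `^ q * (translation_cst k' + 1) else 0.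

Lemma translation_cst_ge0 k : 0 <= translation_cst k.
Proof. by elim: k => //= k IH; rewrite mulr_ge0 ?powR_ge0// addr_ge0. Qed.

Lemma translation_norm0 : translation_norm 0 = 0%E.
Proof.
rewrite /translation_norm integral0_eq// => x _.
by rewrite addr0 subrr normr0 powR0// gt_eqF.
Qed.

Lemma translation_norm_sum (r : R) (y : 'rV[R]_n) (s : seq 'I_n) : 0 <= r ->
  (forall i, 0 <= y ord0 i <= r) ->
  (translation_norm (\sum_(i <- s) y ord0 i *: delta_mx ord0 i)
   <= (translation_cst (size s) * r `^ q)%:E * G)%E.
Proof.
move=> r0 hy; elim: s => [|i s IH].
  by rewrite big_nil translation_norm0/= mul0r mul0e.
have G0 : (0 <= G)%E.
  by apply: le_trans (hG i); apply: integral_ge0 => x _; rewrite lee_fin powR_ge0.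
rewrite big_cons addrC; apply: le_trans (translation_normD _ _) _.
rewrite /= -mulrA EFinM -muleA; apply: lee_wpmul2l; first by rewrite lee_fin powR_ge0.
rewrite mulrDl mul1r EFinD ge0_muleDl ?lee_fin ?mulr_ge0 ?powR_ge0 ?translation_cst_ge0//.
apply: leeD => //; have /andP[] := hy i; rewrite le_eqVlt => /predU1P[<- _|yi0 yir].
  by rewrite scale0r translation_norm0 mule_ge0// lee_fin powR_ge0.
apply: (le_trans (translation_norm_delta _ yi0)).
apply: lee_wpmul2r => //; rewrite lee_fin.
by apply: ge0_ler_powR => //; rewrite ?nnegrE ltW.
Qed.

Lemma translation_norm_le (r : R) (y : 'rV[R]_n) : 0 <= r -> (forall i, 0 <= y ord0 i <= r) ->
  (translation_norm y <= (translation_cst n * r `^ q)%:E * G)%E.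
Proof.
move=> r0 hy; rewrite [y in translation_norm y]row_sum_delta.
apply: le_trans (translation_norm_sum _ r0 hy) _.
by rewrite /index_enum -enumT size_enum_ord.
Qed.

End translation_norm.

(** * The Gagliardo-Nirenberg inequality *)

Section distribution.
Context {R : realType} (n : nat).
Local Notation mu := (@lebesgue_rV R n).
Variables (u : 'rV[R]_n -> R) (g : 'rV[R]_n -> 'rV[R]_n).
Hypothesis ug : is_weak_gradient u g.
Variables (q : R) (G : \bar R).
Hypothesis q1 : 1 < q.
Hypothesis G0 : (0 <= G)%E.
Hypothesis hG : forall i, (\int[mu]_x (`|g x ord0 i| `^ q)%:E <= G)%E.

Let q0 : 0 < q. Proof. exact: lt_trans q1. Qed.
Let mu_ : measurable_fun setT u. Proof. by have [[]] := ug. Qed.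

Definition level (t : R) : set 'rV[R]_n := [set x | t < `|u x|].

Lemma measurable_level t : measurable (level t).
Proof.
have mau : measurable_fun setT (fun x => `|u x|) by exact: measurableT_comp.
have -> : level t = (fun x => `|u x|) @^-1` `]t, +oo[%classic.
  by apply/seteqP; split => x /=; rewrite in_itv/= andbT.
rewrite -[X in measurable X]setTI; apply: mau => //; exact: measurable_itv.
Qed.

Lemma level_le s t : s <= t -> (mu (level t) <= mu (level s))%E.
Proof.
move=> st; apply: le_measure; rewrite ?inE; [exact: measurable_level..|].
by move=> x /=; apply: le_lt_trans.
Qed.

Lemma lebesgue_cube0 (r : R) : 0 <= r ->
  mu (box (0 : 'rV[R]_n) (const_mx r)) = (r ^+ n)%:E.
Proof.
move=> r0; rewrite lebesgue_box; last by move=> i; rewrite !mxE.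
by under eq_bigr do rewrite !mxE subr0; rewrite prodr_const card_ord.
Qed.

(* If [|u x| > t], then at least half of the [y] in the cube of side [r] satisfy
   [|u (x + y)| <= t / 2], hence [|u (x + y) - u x| >= t / 2]. *)
Lemma level_le_translation (t r : R) : 0 < t -> 0 < r ->
  (mu (level (t / 2)) <= (r ^+ n / 2)%:E)%E ->
  (((t / 2) `^ q * (r ^+ n / 2))%:E * mu (level t) <=
   (r ^+ n)%:E * ((translation_cst q n * r `^ q)%:E * G))%E.
Proof.
move=> t0 r0 hr.
pose Q : set 'rV[R]_n := box 0 (const_mx r).
have mQ : measurable Q by exact: measurable_box.
have muQ : mu Q = (r ^+ n)%:E by apply: lebesgue_cube0; exact: ltW.
pose D (p : 'rV[R]_n * 'rV[R]_n) : R := u (p.1 + p.2) - u p.1.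
have mD : measurable_fun setT D.
  apply: measurable_funB; last exact: (measurableT_comp mu_ measurable_fst).
  apply: (measurableT_comp mu_); apply/measurable_fun_rVP => i.
  under eq_fun do rewrite mxE.
  apply: measurable_funD.
    exact: (measurableT_comp (measurable_coord i) measurable_fst).
  exact: (measurableT_comp (measurable_coord i) measurable_snd).
(* Tonelli is used on [K] in both orders: integrating first in [y] bounds it below through the good
   half of the cube, integrating first in [x] bounds it above through the translation estimate. *)
pose K (p : 'rV[R]_n * 'rV[R]_n) := (`|D p| `^ q * \1_Q p.2)%:E.
have mK : measurable_fun setT K.
  apply/measurable_EFinP; apply: measurable_funM.
    by apply/measurable_EFinP; exact: measurable_norm_powR.
  by apply: measurableT_comp; [exact: measurable_indic|exact: measurable_snd].
have K0 p : (0 <= K p)%E by rewrite lee_fin mulr_ge0 ?powR_ge0.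
have E1 : (\int[mu]_x (((t / 2) `^ q * (r ^+ n / 2)) * \1_(level t) x)%:E <=
           \int[mu]_x \int[mu]_y K (x, y))%E.
{ apply: ge0_le_integral => //.
  - by move=> x _; rewrite lee_fin !mulr_ge0 ?powR_ge0 ?exprn_ge0// ltW.
  - apply/measurable_EFinP; apply: measurable_funM; first exact: measurable_cst.
    by apply: measurable_indic; exact: measurable_level.
  - exact: measurable_fun_fubini_tonelli_F.
  - move=> x _; rewrite indicE; have [/set_mem xt|_] := boolP (x \in level t); last first.
      by rewrite mulr0; exact: integral_ge0.
    rewrite mulr1.
    (* The bad [y]: a translate of the level set of [t / 2], hence of measure at most half that of
       the cube. *)
    pose F := [set y | t / 2 < `|u (x + y)|].
    have FE : F = (fun y => y + x) @^-1` (level (t / 2)).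
      by apply/seteqP; split => y /=; rewrite /F/= addrC.
    have mF : measurable F.
      rewrite FE -[X in measurable X]setTI; apply: measurable_shift => //.
      exact: measurable_level.
    have muF : (mu F <= (r ^+ n / 2)%:E)%E.
      by rewrite FE lebesgue_shift//; exact: measurable_level.
    have mQF : measurable (Q `\` F) by exact: measurableD.
    have muQF : ((r ^+ n / 2)%:E <= mu (Q `\` F))%E.
      have : ((r ^+ n)%:E <= mu (Q `\` F) + (r ^+ n / 2)%:E)%E.
        rewrite -muQ [X in (X <= _)%E](measureDI mu mQ mF).
        apply: leeD => //; apply: le_trans muF; apply: le_measure; rewrite ?inE//.
        by apply: measurableI.
      rewrite -leeBlDr// -EFinB.
      by congr (_ <= _)%E; congr (_%:E); lra.
    apply: (@le_trans _ _ (\int[mu]_y ((t / 2) `^ q * \1_(Q `\` F) y)%:E)%E).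
      under eq_integral do rewrite EFinM.
      rewrite ge0_integralZl_EFin//; [|by apply/measurable_EFinP; exact: measurable_indic
        |exact: powR_ge0].
      rewrite integral_indic// setIT EFinM.
      by apply: lee_wpmul2l; rewrite ?lee_fin ?powR_ge0.
    apply: ge0_le_integral => //.
    + by move=> y _; rewrite lee_fin mulr_ge0// powR_ge0.
    + by apply/measurable_EFinP; apply: measurable_funM; [exact: measurable_cst|exact: measurable_indic].
    + exact: (measurableT_comp mK (pair1_measurable x)).
    + move=> y _; rewrite lee_fin /D/= !indicE.
      have [/set_mem[yQ yF]|_] := boolP (y \in Q `\` F); last first.
        by rewrite mulr0 mulr_ge0// powR_ge0.
      rewrite mem_set// !mulr1; apply: ge0_ler_powR; rewrite ?nnegrE ?(ltW q0) ?divr_ge0 ?(ltW t0)//.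
      move/negP: yF; rewrite -leNgt => yF; rewrite distrC.
      apply: le_trans (lerB_dist _ _); move: xt yF; rewrite /level/=; lra. }
have -> : (((t / 2) `^ q * (r ^+ n / 2))%:E * mu (level t))%E =
  (\int[mu]_x (((t / 2) `^ q * (r ^+ n / 2)) * \1_(level t) x)%:E)%E.
{ under [RHS]eq_integral do rewrite EFinM.
  rewrite ge0_integralZl_EFin//.
  - by rewrite integral_indic ?setIT//; exact: measurable_level.
  - by apply/measurable_EFinP; apply: measurable_indic; exact: measurable_level.
  - by rewrite mulr_ge0 ?powR_ge0// divr_ge0// exprn_ge0// ltW. }
apply: (le_trans E1).
rewrite (fubini_tonelli K)//.
apply: (@le_trans _ _ (\int[mu]_y ((\1_Q y)%:E * ((translation_cst q n * r `^ q)%:E * G)))%E).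
{ apply: ge0_le_integral => //.
  - by move=> y _; exact: integral_ge0.
  - exact: measurable_fun_fubini_tonelli_G.
  - apply: emeasurable_funM; last exact: measurable_cst.
    by apply/measurable_EFinP; exact: measurable_indic.
  - move=> y _; rewrite indicE; have [/set_mem yQ|yQ] := boolP (y \in Q); last first.
      by rewrite mul0e integral0_eq// => x _; rewrite /K/= indicE (negPf yQ) mulr0.
    rewrite mul1e.
    apply: le_trans (translation_norm_le ug q1 hG (y := y) (ltW r0) _).
      rewrite /translation_norm; under eq_integral do rewrite /K/= indicE mem_set// mulr1.
      by [].
    by move=> i; have := yQ i; rewrite !mxE in_itv/= => /andP[/ltW -> ->]. }
have CG0 : (0 <= (translation_cst q n * r `^ q)%:E * G)%E.
  by rewrite mule_ge0// lee_fin mulr_ge0 ?powR_ge0 ?translation_cst_ge0.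
rewrite ge0_integralZr//; last by apply/measurable_EFinP; exact: measurable_indic.
by rewrite integral_indic// setIT -[X in (_ <= X * _)%E]muQ.
Qed.

End distribution.

(** * Real-variable estimates for the interpolation *)

Section real_estimates.
Context {R : realType}.

(* The a priori bound [S] makes the supremum [W] of [M t * t `^ s] finite, so that
   [W <= B * W `^ (q / k)] can be divided by [W `^ (q / k)]. *)
Lemma weak_type_bound (M : R -> R) (A S q s k : R) : 0 < q < k -> s = q * k / (k - q) ->
  0 <= A -> (forall t, 0 <= M t) ->
  (forall t, 0 < t -> M t * t `^ q <= A * M (t / 2) `^ (q / k)) ->
  (forall t, 0 < t -> M t * t `^ s <= S) ->
  forall t, 0 < t -> M t * t `^ s <= (A * 2 `^ (s * (q / k))) `^ (k / (k - q)).
Proof.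
move=> /andP[q0 qk] sE A0 M0 hA hS.
have k0 : 0 < k by exact: lt_trans qk.
have kq0 : 0 < k - q by rewrite subr_gt0.
have s0 : 0 < s by rewrite sE divr_gt0// mulr_gt0.
pose E := [set M t * t `^ s | t in [set t | 0 < t]].
have hE : has_ubound E by exists S => _ [t t0 <-]; exact: hS.
pose W := sup E.
have MW t : 0 < t -> M t * t `^ s <= W by move=> t0; apply: ub_le_sup => //; exists t.
have W0 : 0 <= W by apply: le_trans (MW 1 ltr01); rewrite mulr_ge0 ?powR_ge0.
pose B := A * 2 `^ (s * (q / k)).
have B0 : 0 <= B by rewrite mulr_ge0 ?powR_ge0.
have WB : W <= B * W `^ (q / k).
  apply: ge_sup; first by exists (M 1 * 1 `^ s), 1 => //=.
  move=> _ [t /= t0 <-].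
  (* The definition of [s] amounts to [s = q + s (q / k)], so the hypothesis at [t] calls for
     exactly the quantity bounded by [W] at [t / 2]. *)
  have -> : t `^ s = t `^ q * ((t / 2) `^ s * 2 `^ s) `^ (q / k).
    rewrite -powRM ?divr_ge0 ?(ltW t0)// divfK// -powRrM -powRD; last by rewrite (gt_eqF t0) implybT.
    by congr (_ `^ _); rewrite sE; field; rewrite ?gt_eqF//.
  rewrite mulrA powRM ?powR_ge0// -[(2 `^ s) `^ _]powRrM.
  apply: (@le_trans _ _ (A * M (t / 2) `^ (q / k) * (((t / 2) `^ s) `^ (q / k) * 2 `^ (s * (q / k))))).
    by apply: ler_wpM2r; [rewrite mulr_ge0 ?powR_ge0|exact: hA].
  rewrite [leLHS](_ : _ = B * (M (t / 2) * (t / 2) `^ s) `^ (q / k)); last first.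
    by rewrite powRM ?powR_ge0// /B; ring.
  apply: ler_wpM2l => //; apply: ge0_ler_powR; rewrite ?nnegrE ?mulr_ge0 ?powR_ge0 ?invr_ge0 ?(ltW q0) ?(ltW k0)//.
  by apply: MW; exact: divr_gt0.
move=> t t0; apply: (le_trans (MW _ t0)).
have [W00|Wn0] := eqVneq W 0; first by rewrite W00 powR_ge0.
have Wp : 0 < W by rewrite lt_def Wn0.
have W1 : W `^ ((k - q) / k) <= B.
  rewrite -(ler_pM2r (powR_gt0 (q / k) Wp)) -powRD ?Wn0 ?implybT//.
  rewrite (_ : _ + _ = 1) ?powRr1//; field; rewrite ?gt_eqF//.
have -> : W = (W `^ ((k - q) / k)) `^ (k / (k - q)).
  by rewrite -powRrM (_ : _ * _ = 1) ?powRr1//; field; rewrite ?gt_eqF.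
by apply: ge0_ler_powR; rewrite ?nnegrE ?powR_ge0 ?divr_ge0 ?(ltW kq0) ?(ltW k0).
Qed.

Lemma powR_layer (p T v : R) : 2 < p -> 0 < T -> 0 <= v ->
  ((v `^ p)%:E <= (T `^ (p - 2) * v `^ 2)%:E +
    \sum_(0 <= k <oo) ((2 ^+ k.+1 * T) `^ p * (2 ^+ k * T < v)%R%:R)%:E)%E.
Proof.
move=> p2 T0 v0.
have p0 : 0 < p by exact: lt_trans p2.
have terms0 (k : nat) : (0 <= ((2 ^+ k.+1 * T) `^ p * (2 ^+ k * T < v)%R%:R)%:E)%E.
  by rewrite lee_fin mulr_ge0 ?powR_ge0.
have [vT|Tv] := leP v T.
  apply: (@le_trans _ _ (T `^ (p - 2) * v `^ 2)%:E); last by rewrite leeDl// nneseries_ge0.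
  rewrite lee_fin; have [->|vn0] := eqVneq v 0; first by rewrite !powR0 ?mulr0 ?gt_eqF.
  have -> : v `^ p = v `^ (p - 2) * v `^ 2.
    by rewrite -powRD ?vn0 ?implybT// subrK.
  apply: ler_wpM2r; first exact: powR_ge0.
  by apply: ge0_ler_powR; rewrite ?nnegrE ?subr_ge0 ?(ltW p2) ?(ltW T0).
have exk : exists k : nat, v <= 2 ^+ k.+1 * T.
  exists (Num.trunc (v / T)).
  rewrite -ler_pdivrMr// ltW// (lt_le_trans (truncnS_gt _))//.
  by rewrite -natrX ler_nat ltnW// ltn_expl.
case: (ex_minnP exk) => k vk mink.
have kv : 2 ^+ k * T < v.
  case: k vk mink => [|k] vk mink; first by rewrite expr0 mul1r.
  by rewrite ltNge; apply/negP => /mink; rewrite ltnn.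
apply: (@le_trans _ _ (\sum_(0 <= k <oo) ((2 ^+ k.+1 * T) `^ p * (2 ^+ k * T < v)%R%:R)%:E)%E); last first.
  by rewrite leeDr// lee_fin mulr_ge0 ?powR_ge0.
apply: le_trans (nneseries_lim_ge k.+1 _); last by move=> *; exact: terms0.
rewrite big_nat_recr//= kv mulr1.
apply: (@le_trans _ _ ((2 ^+ k.+1 * T) `^ p)%:E).
  rewrite lee_fin; apply: ge0_ler_powR; rewrite ?nnegrE ?(ltW p0)//.
  by rewrite mulr_ge0 ?exprn_ge0 ?(ltW T0).
by rewrite leeDr// sume_ge0.
Qed.

(** The terms are geometric with ratio [2]^ (p - s)[, less than 1 because]p < s[. They are the
    dyadic layers estimated by a weak-type bound]W * t [^ (- s)]. *)
Lemma geometric_layer_sum (W T p s : R) : 0 <= W -> 0 < T -> 0 < p < s ->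
  (\sum_(0 <= k <oo) ((2 ^+ k.+1 * T) `^ p * (W * ((2 ^+ k * T) `^ (- s))))%:E <=
   (2 `^ p / (1 - 2 `^ (p - s)) * W * T `^ (p - s))%:E)%E.
Proof.
move=> W0 T0 /andP[p0 ps].
pose z := 2 `^ (p - s) : R.
have z0 : 0 <= z by exact: powR_ge0.
have z1 : z < 1.
  have ps0 : 0 < s - p by rewrite subr_gt0.
  rewrite /z -opprB powRN invf_lt1 ?powR_gt0//.
  apply: (@le_lt_trans _ _ (1 `^ (s - p))); first by rewrite powR1.
  by apply: gt0_ltr_powR; rewrite ?nnegrE// ltr1n.
pose a := 2 `^ p * W * T `^ (p - s).
have a0 : 0 <= a by rewrite !mulr_ge0 ?powR_ge0.
have termE (k : nat) : (2 ^+ k.+1 * T) `^ p * (W * ((2 ^+ k * T) `^ (- s))) = geometric a z k.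
  have b0 : 0 < 2 ^+ k * T by rewrite mulr_gt0// exprn_gt0.
  have zk : (2 ^+ k) `^ (p - s) = z ^+ k.
    by rewrite -(powR_mulrn k (ler0n R 2)) -(powR_mulrn k z0); exact: powRAC.
  have bps : (2 ^+ k * T) `^ p * (2 ^+ k * T) `^ (- s) = z ^+ k * T `^ (p - s).
    by rewrite -powRD ?(gt_eqF b0) ?implybT// powRM ?exprn_ge0 ?(ltW T0)// zk.
  transitivity (2 `^ p * W * ((2 ^+ k * T) `^ p * (2 ^+ k * T) `^ (- s))).
    by rewrite exprS -mulrA powRM ?(ltW b0)//; ring.
  by rewrite bps /geometric/= /a; ring.
apply: lime_le; first by apply: is_cvg_nneseries => k _ _; rewrite termE lee_fin geometric_ge0.
apply: nearW => m; under eq_bigr do rewrite termE.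
rewrite sumEFin lee_fin -[leLHS]/(series (geometric a z) m) geometric_seriesE ?lt_eqF//.
have -> : 2 `^ p / (1 - 2 `^ (p - s)) * W * T `^ (p - s) = a / (1 - z) by rewrite /a /z; ring.
rewrite ler_pdivrMr ?subr_gt0// divfK ?subr_eq0 ?gt_eqF//.
by rewrite ler_piMr// gerBl exprn_ge0.
Qed.

End real_estimates.

(** * Interpolation between L^2 and the weak-type bound *)

Section gagliardo_nirenberg.
Context {R : realType} (n : nat).
Local Notation mu := (@lebesgue_rV R n).
Variables (q p s : R).
Hypotheses (qn : 1 < q < n%:R) (pE : p = q * (1 + 2 / n%:R)) (sE : s = q * n%:R / (n%:R - q)).
Hypotheses (p2 : 2 < p) (ps : p < s).

Let q1 : 1 < q. Proof. by case/andP: qn. Qed.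
Let q0 : 0 < q. Proof. exact: lt_trans q1. Qed.
Let qltn : q < n%:R. Proof. by case/andP: qn. Qed.
Let n0 : 0 < n%:R :> R. Proof. exact: lt_trans qltn. Qed.
Let nq0 : 0 < n%:R - q. Proof. by rewrite subr_gt0. Qed.
Let ngt0 : (0 < n)%N. Proof. by rewrite -(ltr0n R). Qed.

(** The factor 2 comes from the half cube, [2]^ q[from replacing]t / 2[by]t[, and]2 [^ (q / n%:R)]
    from the side of a cube twice as large as the level set. *)
Definition decay_cst : R := 2 * translation_cst q n * 2 `^ q * 2 `^ (q / n%:R).

Lemma decay_cst_gt0 : 0 < decay_cst.
Proof.
rewrite /decay_cst !mulr_gt0 ?powR_gt0//.
by case: n ngt0 => //= k _; rewrite mulr_gt0 ?powR_gt0// ltr_wpDl// translation_cst_ge0.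
Qed.

(** The two terms of [integral_layer] are balanced, which explains the sum in the first factor; the
    second is the base of the weak-type constant without the gradient bound. *)
Definition gn_cst : R :=
  (1 + 2 `^ p / (1 - 2 `^ (p - s))) * (decay_cst * 2 `^ (s * (q / n%:R))).

Variables (u : 'rV[R]_n -> R) (g : 'rV[R]_n -> 'rV[R]_n).
Hypothesis ug : is_weak_gradient u g.
Let mu_ : measurable_fun setT u. Proof. by have [[]] := ug. Qed.

Lemma chebyshev_level (r t : R) : 0 < r -> 0 < t ->
  ((t `^ r)%:E * mu (level u t) <= \int[mu]_x (`|u x| `^ r)%:E)%E.
Proof.
move=> r0 t0; have mt := measurable_level ug t.
have -> : mu (level u t) = (\int[mu]_x (\1_(level u t) x)%:E)%E.
  by rewrite integral_indic// setIT.
rewrite -ge0_integralZl_EFin ?powR_ge0//; last first.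
  by apply/measurable_EFinP; exact: measurable_indic.
apply: ge0_le_integral => //.
- by move=> x _; rewrite -EFinM lee_fin mulr_ge0// powR_ge0.
- by apply: emeasurable_funM; [exact: measurable_cst|apply/measurable_EFinP; exact: measurable_indic].
- exact: measurable_norm_powR.
- move=> x _; rewrite -EFinM lee_fin indicE; have [/set_mem xt|_] := boolP (x \in _); last first.
    by rewrite mulr0 powR_ge0.
  rewrite mulr1; apply: ge0_ler_powR; rewrite ?nnegrE ?(ltW r0) ?(ltW t0)//.
  exact: ltW.
Qed.

Variables (c2 S : R) (c20 : 0 < c2).
Hypothesis u2 : (\int[mu]_x (`|u x| `^ 2)%:E = c2%:E)%E.
Hypothesis us : (\int[mu]_x (`|u x| `^ s)%:E <= S%:E)%E.

Let M t := fine (mu (level u t)).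

Let ME t : 0 < t -> mu (level u t) = (M t)%:E.
Proof.
move=> t0; rewrite /M fineK// ge0_fin_numE; last exact: measure_ge0.
have := chebyshev_level (ltr0Sn R 1) t0.
rewrite u2 -lee_pdivlMl ?powR_gt0// => /le_lt_trans; apply.
by rewrite -EFinM ltry.
Qed.

Let M_ge0 t : 0 <= M t.
Proof. by apply: fine_ge0; exact: measure_ge0. Qed.

Section fixed_gradient_bound.
Variable G : R.
Hypothesis G0 : 0 < G.
Hypothesis hG : forall i, (\int[mu]_x (`|g x ord0 i| `^ q)%:E <= G%:E)%E.

(** [level_le_translation] with the smallest cube it allows. If the level set of [t / 2] is null
    this cube degenerates, but then the level set of [t] is null too. *)
Let decay t : 0 < t -> M t * t `^ q <= decay_cst * G * M (t / 2) `^ (q / n%:R).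
Proof.
move=> t0; have t20 : 0 < t / 2 by rewrite divr_gt0.
have [M0|Mn0] := eqVneq (M (t / 2)) 0.
  have : M t <= M (t / 2).
    rewrite -lee_fin -!ME//; apply: (level_le ug).
    by rewrite ler_pdivrMr// ler_pMr// ler1n.
  rewrite M0 => Mt; have -> : M t = 0 by apply/eqP; rewrite eq_le Mt M_ge0.
  by rewrite mul0r powR0 ?mulr0// mulf_neq0 ?invr_eq0 ?gt_eqF.
have Mp : 0 < M (t / 2) by rewrite lt_def Mn0 M_ge0.
pose r := (2 * M (t / 2)) `^ n%:R^-1.
have r0 : 0 < r by rewrite powR_gt0// mulr_gt0.
have rn : r ^+ n = 2 * M (t / 2).
  by rewrite -powR_mulrn ?powR_ge0// -powRrM mulVf ?gt_eqF// powRr1// mulr_ge0.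
have rq : r `^ q = 2 `^ (q / n%:R) * M (t / 2) `^ (q / n%:R).
  by rewrite -powRM ?(ltW Mp)// /r -powRrM (mulrC n%:R^-1).
have rn2 : r ^+ n / 2 = M (t / 2) by rewrite rn; field.
have := level_le_translation ug q1 (G := G%:E) (ltW G0) hG t0 r0.
rewrite !ME// rn2 lexx => /(_ isT).
rewrite -!EFinM lee_fin rn rq => H.
have tq : t `^ q = 2 `^ q * (t / 2) `^ q.
  by rewrite -powRM ?(ltW t20)//; congr (_ `^ _); field.
rewrite tq -(ler_pM2l Mp); apply: (@le_trans _ _ (2 `^ q * ((t / 2) `^ q * M (t / 2) * M t))).
  by rewrite le_eqVlt; apply/orP; left; apply/eqP; ring.
apply: le_trans (ler_wpM2l (powR_ge0 2 q) H) _.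
by rewrite le_eqVlt /decay_cst; apply/orP; left; apply/eqP; ring.
Qed.

(** The a priori bound [S] serves as a finiteness statement: its size does not enter [W]. *)
Let W := (decay_cst * G * 2 `^ (s * (q / n%:R))) `^ (n%:R / (n%:R - q)).

Let weak t : 0 < t -> M t * t `^ s <= W.
Proof.
have s0 : 0 < s by rewrite sE divr_gt0 ?mulr_gt0.
apply: (weak_type_bound (S := S)) => //.
- by rewrite q0.
- rewrite mulr_ge0 ?(ltW G0)// /decay_cst !mulr_ge0 ?powR_ge0//.
  exact: translation_cst_ge0.
- move=> t' t'0; rewrite -lee_fin EFinM muleC -ME//.
  exact: le_trans (chebyshev_level s0 t'0) us.
Qed.

(** Integrates [powR_layer]: up to height [T] the mass controls [u], above it the weak-type bound
    controls the dyadic levels. *)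
Lemma integral_layer (T : R) : 0 < T ->
  (\int[mu]_x (`|u x| `^ p)%:E <=
   (T `^ (p - 2) * c2 + 2 `^ p / (1 - 2 `^ (p - s)) * W * T `^ (p - s))%:E)%E.
Proof.
move=> T0; have p0 : 0 < p by exact: lt_trans p2.
have W0 : 0 <= W by exact: powR_ge0.
pose f (k : nat) x : \bar R := ((2 ^+ k.+1 * T) `^ p * \1_(level u (2 ^+ k * T)) x)%:E.
have mf k : measurable_fun setT (f k).
  apply/measurable_EFinP; apply: measurable_funM; first exact: measurable_cst.
  by apply: measurable_indic; exact: (measurable_level ug).
have f0 k x : (0 <= f k x)%E by rewrite lee_fin mulr_ge0 ?powR_ge0.
have mu2 : measurable_fun setT (fun x => (T `^ (p - 2) * `|u x| `^ 2)%:E).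
  apply/measurable_EFinP; apply: measurable_funM; first exact: measurable_cst.
  by apply/measurable_EFinP; exact: measurable_norm_powR.
apply: (@le_trans _ _ (\int[mu]_x ((T `^ (p - 2) * `|u x| `^ 2)%:E + \sum_(0 <= k <oo) f k x))%E).
{ apply: ge0_le_integral => //.
  - exact: measurable_norm_powR.
  - by apply: emeasurable_funD => //; apply: ge0_emeasurable_sum => // k x _ _; exact: f0.
  - move=> x _; apply: le_trans (powR_layer p2 T0 (normr_ge0 (u x))) _.
    apply: leeD => //; rewrite le_eqVlt; apply/orP; left; apply/eqP.
    apply: eq_eseriesr => k _; rewrite /f indicE; congr ((_ * _%:R)%:E).
    by apply: congr1; apply/idP/idP => [h|/set_mem//]; exact/mem_set. }
rewrite ge0_integralD//; [|by move=> x _; rewrite lee_fin mulr_ge0 ?powR_ge0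
  |by move=> x _; exact: nneseries_ge0|by apply: ge0_emeasurable_sum => // k x _ _; exact: f0].
under eq_integral do rewrite EFinM.
rewrite ge0_integralZl_EFin ?powR_ge0//; last exact: measurable_norm_powR.
rewrite u2 -EFinM integral_nneseries// EFinD; apply: leeD => //.
apply: le_trans (geometric_layer_sum W0 T0 _); last by rewrite p0.
apply: lee_nneseries => [k _ _|k _]; first exact: integral_ge0.
have k0 : 0 < 2 ^+ k * T by rewrite mulr_gt0 ?exprn_gt0.
rewrite /f; under eq_integral do rewrite EFinM.
rewrite ge0_integralZl_EFin ?powR_ge0//; last first.
  by apply/measurable_EFinP; apply: measurable_indic; exact: (measurable_level ug).
rewrite integral_indic//; last exact: (measurable_level ug).
rewrite setIT [X in (_ * X <= _)%E](_ : _ = (M (2 ^+ k * T))%:E); last exact: ME.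
rewrite -EFinM lee_fin ler_wpM2l ?powR_ge0//.
by rewrite powRN ler_pdivlMr ?powR_gt0//; exact: weak.
Qed.

Lemma gagliardo_nirenberg_pos :
  (\int[mu]_x (`|u x| `^ p)%:E <= (gn_cst * c2 `^ (q / n%:R) * G)%:E)%E.
Proof.
have B0 : 0 < decay_cst * G * 2 `^ (s * (q / n%:R)).
  by rewrite mulr_gt0 ?powR_gt0// mulr_gt0// decay_cst_gt0.
have W0 : 0 < W by exact: powR_gt0.
have s2 : 0 < s - 2 by rewrite subr_gt0; exact: lt_trans ps.
have Wc : 0 < W / c2 by exact: divr_gt0.
(* This [T] balances the two terms of [integral_layer]. *)
pose T := (W / c2) `^ (s - 2)^-1.
have T0 : 0 < T by exact: powR_gt0.
apply: (le_trans (integral_layer T0)); rewrite lee_fin.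
have T2 : T `^ (s - 2) = W / c2.
  by rewrite /T -powRrM mulVf ?gt_eqF// powRr1// ltW.
have WT : W * T `^ (p - s) = T `^ (p - 2) * c2.
  have -> : p - s = (p - 2) - (s - 2) by ring.
  by rewrite powRB ?(gt_eqF T0) ?implybT// T2; field; rewrite ?gt_eqF.
(* The value of [p] enters here: the numerator of [s - 2] over [n%:R - q] equals [(p - 2) * n%:R].
   The resulting exponent cancels that of [W], leaving [G] to the power one. *)
have th : (s - 2)^-1 * (p - 2) = (n%:R - q) / n%:R.
  have X0 : q * n%:R + -2 * (n%:R - q) != 0.
    have : 0 < (p - 2) * n%:R by rewrite mulr_gt0// subr_gt0.
    rewrite pE => X; rewrite gt_eqF//; apply: lt_le_trans X _.
    by rewrite le_eqVlt; apply/orP; left; apply/eqP; field; rewrite ?gt_eqF.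
  by rewrite sE pE; field; rewrite X0 !gt_eqF.
have TB : T `^ (p - 2) * c2 = decay_cst * G * 2 `^ (s * (q / n%:R)) * c2 `^ (q / n%:R).
  rewrite /T -powRrM th powRM ?invr_ge0 ?(ltW W0) ?(ltW c20)//.
  rewrite /W -powRrM (_ : _ / _ * _ = 1); last by field; rewrite ?gt_eqF.
  rewrite powRr1 ?(ltW B0)// -mulrA; congr (_ * _).
  rewrite -(powR_inv1 (ltW c20)) -powRrM -[X in _ * X](powRr1 (ltW c20)).
  rewrite -powRD ?(gt_eqF c20) ?implybT//; congr (_ `^ _); field; rewrite ?gt_eqF//.
have -> : 2 `^ p / (1 - 2 `^ (p - s)) * W * T `^ (p - s) =
    2 `^ p / (1 - 2 `^ (p - s)) * (W * T `^ (p - s)) by rewrite mulrA.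
rewrite WT TB /gn_cst le_eqVlt; apply/orP; left; apply/eqP.
set K := 2 `^ p / _; ring.
Qed.

End fixed_gradient_bound.

Lemma gagliardo_nirenberg (G : R) : 0 <= G ->
  (forall i, (\int[mu]_x (`|g x ord0 i| `^ q)%:E <= G%:E)%E) ->
  (\int[mu]_x (`|u x| `^ p)%:E <= (gn_cst * c2 `^ (q / n%:R) * G)%:E)%E.
Proof.
move=> G0 hG; set K := gn_cst * _.
apply/lee_addgt0Pr => e e0.
have K1 : 0 < `|K| + 1 by rewrite ltr_wpDl.
have Ge : 0 < G + e / (`|K| + 1) by rewrite ltr_wpDl// divr_gt0.
apply: le_trans (gagliardo_nirenberg_pos Ge _) _.
  by move=> i; apply: le_trans (hG i) _; rewrite lee_fin lerDl ltW// divr_gt0.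
rewrite -EFinD lee_fin -/K mulrDr lerD2l mulrCA ger_pMr//.
by rewrite ler_pdivrMr// mul1r (le_trans (ler_norm K))// lerDl.
Qed.

End gagliardo_nirenberg.

(** * Gradients of test functions *)

Section cube_support.
Context {R : realType} (n : nat).
Local Notation mu := (@lebesgue_rV R n).
Implicit Types (phi : 'rV[R]_n -> R) (x : 'rV[R]_n) (i : 'I_n).

Definition cube_support (M : R) phi := forall x i, M < `|x ord0 i| -> phi x = 0.

Lemma coord_le_norm x i : `|x ord0 i| <= `|x|.
Proof.
by rewrite [leRHS]/Num.norm/= mx_normrE; apply/bigmax_geP; right; exists (ord0, i).
Qed.

Lemma test_function_cube_support phi : test_function phi -> exists M, cube_support M phi.
Proof.
move=> [_ /compact_bounded[M [Mreal hM]]].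
exists (M + 1) => x i hx; apply/eqP; apply: contraLR hx => phi0.
rewrite -leNgt; apply: le_trans (coord_le_norm x i) _.
apply: hM; first by rewrite ltrDl.
exact: subset_closure.
Qed.

Lemma cube_support_partial M phi i : cube_support M phi -> cube_support M (partial i phi).
Proof.
move=> h x j hx; rewrite /partial -(derive_cst (0 : R) x (delta_mx ord0 i)).
apply: near_eq_derive; near=> y; apply: (h y j); near: y.
have : {for x, continuous (fun y : 'rV[R]_n => `|y ord0 j|)}.
  apply: (@continuous_comp _ _ _ (fun y : 'rV[R]_n => y ord0 j) Num.norm).
    exact: coord_continuous.
  exact: norm_continuous.
by move/cvgr_gt; apply.
Unshelve. all: by end_near. Qed.

Lemma cube_support_bounded M phi : continuous phi -> cube_support M phi ->
  exists2 C, 0 <= C & forall x, `|phi x| <= C.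
Proof.
move=> cphi h.
pose K := [set v : 'rV[R]_n | forall i, v ord0 i \in `[- M, M]].
have cK : compact K.
  by apply: (@rV_compact _ _ (fun=> `[- M, M]%classic)) => _; exact: segment_compact.
have : compact (phi @` K) by apply: continuous_compact => //; exact: continuous_subspaceT.
move/compact_bounded => [C [Creal hC]].
exists (`|C| + 1); first by rewrite addr_ge0.
move=> x; have [xK|/existsNP[i xi]] := pselect (K x).
  by apply: hC; [rewrite (le_lt_trans (ler_norm C))// ltrDl|exists x].
rewrite (h x i) ?normr0 ?addr_ge0// ltNge; apply/negP => hx; apply: xi.
by rewrite in_itv/= -ler_norml.
Qed.

(** Boxes are open on the left, so the lower corner is moved out by one to contain the closed
    cube. *)
Lemma cube_support_box M phi x : cube_support M phi ->
  ~ box (const_mx (- M - 1)) (const_mx M) x -> phi x = 0.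
Proof.
move=> h /existsNP[i]; rewrite !mxE in_itv/= => /negP; rewrite negb_and -leNgt -ltNge => hx.
apply: (h x i); rewrite ltNge ler_norml; apply/negP => /andP[h1 h2].
by case/orP: hx; lra.
Qed.

Lemma box_integrable_cst1 : box_integrable (cst 1 : 'rV[R]_n -> R).
Proof.
move=> a b; apply: (measurable_bounded_integrable (measurable_box a b)).
- exact: lebesgue_box_lty.
- exact: measurable_cst.
- by exists 1; split=> // M' M1 x _; rewrite /= normr1 ltW.
Qed.

Lemma cube_support_integrable M phi : continuous phi -> cube_support M phi ->
  mu.-integrable setT (EFin \o phi).
Proof.
move=> cphi h; have [C C0 hC] := cube_support_bounded cphi h.
have mphi := continuous_measurable_rV cphi.
have := box_integrable_mul (measurable_cst _) box_integrable_cst1 mphi hC (fun x => @cube_support_box M phi x h).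
by apply: eq_integrable => // x _; rewrite mul1r.
Qed.

Lemma integrable_locally_integrable_rV (f : 'rV[R]_n -> R) :
  mu.-integrable setT (EFin \o f) -> locally_integrable_rV f.
Proof.
move=> /integrableP[/measurable_EFinP mf foo]; split => // K cK.
have clK : closed K by apply: compact_closed => //; exact: norm_hausdorff.
have mK : measurable K.
  rewrite -(setCK K); apply: measurableC; apply: open_measurable_rV.
  exact: closed_openC.
apply: le_lt_trans foo; apply: ge0_subset_integral => //.
by apply/measurable_EFinP; exact: measurableT_comp.
Qed.

Lemma cube_support_locally_integrable M phi : continuous phi -> cube_support M phi ->
  locally_integrable_rV phi.
Proof. by move=> cphi h; apply: integrable_locally_integrable_rV; exact: cube_support_integrable h. Qed.

Lemma is_derive_line phi x i (t : R) : derivable phi (t *: delta_mx ord0 i + x) (delta_mx ord0 i) ->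
  is_derive t 1 (fun s => phi (s *: delta_mx ord0 i + x)) (partial i phi (t *: delta_mx ord0 i + x)).
Proof.
move=> d.
have E : (fun h => h^-1 *: (((fun s => phi (s *: delta_mx ord0 i + x)) \o shift t) (h *: 1) - phi (t *: delta_mx ord0 i + x))) =
   (fun h => h^-1 *: ((phi \o shift (t *: delta_mx ord0 i + x)) (h *: delta_mx ord0 i) - phi (t *: delta_mx ord0 i + x))).
  by apply/funext => h; rewrite /= [h *: 1]mulr1 scalerDl addrA.
apply: DeriveDef; first by rewrite /derivable E.
by rewrite /derive E.
Qed.

Lemma partial_increment_le phi x i (C h : R) : 0 < h ->
  (forall y, derivable phi y (delta_mx ord0 i)) -> (forall y, `|partial i phi y| <= C) ->
  `|phi (h *: delta_mx ord0 i + x) - phi x| <= C * h.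
Proof.
move=> h0 d hC.
pose f (s : R) := phi (s *: delta_mx ord0 i + x).
have df (s : R) : is_derive s 1 f (partial i phi (s *: delta_mx ord0 i + x)) by exact: is_derive_line.
have cf : continuous f.
  by move=> s; apply/differentiable_continuous/derivable1_diffP; case: (df s).
have [c _] := @MVT_segment R f (fun s => partial i phi (s *: delta_mx ord0 i + x)) 0 h (ltW h0)
  (fun s _ => df s) (continuous_subspaceT cf).
rewrite /f scale0r add0r subr0 => ->.
by rewrite normrM (gtr0_norm h0) ler_wpM2r// ltW.
Qed.

(* The difference quotients have zero integral by translation invariance. *)
Lemma integral_partial_eq0 M phi i : continuous phi -> cube_support M phi ->
  (forall y, derivable phi y (delta_mx ord0 i)) -> continuous (partial i phi) ->
  (\int[mu]_x (partial i phi x)%:E = 0)%E.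
Proof.
move=> cphi hs d cd.
have [C C0 hC] := cube_support_bounded cd (@cube_support_partial M phi i hs).
have mphi := continuous_measurable_rV cphi.
have iphi := cube_support_integrable cphi hs.
pose e : 'rV[R]_n := delta_mx ord0 i.
pose f (k : nat) (x : 'rV[R]_n) : R := k.+1%:R * (phi (k.+1%:R^-1 *: e + x) - phi x).
have msh (k : nat) : measurable_fun setT (fun x : 'rV[R]_n => phi (k.+1%:R^-1 *: e + x)).
  by under eq_fun do rewrite addrC; exact: (measurableT_comp mphi (measurable_shift _)).
have f0 k : (\int[mu]_x (f k x)%:E = 0)%E.
  have ish := integrable_shift (k.+1%:R^-1 *: e) iphi.
  under eq_integral do rewrite EFinM EFinB.
  rewrite integralZl//; last first.
    by apply: integrableB => //; apply: eq_integrable ish => // x _; rewrite addrC.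
  rewrite integralB//; last by apply: eq_integrable ish => // x _; rewrite /= addrC.
  under [X in (_ * (X - _))%E]eq_integral do rewrite addrC.
  rewrite (integral_shift _ (f := EFin \o phi)); last exact: measurable_int iphi.
  by rewrite subee ?mule0//; exact: integrable_fin_num.
(* One unit absorbs the shift by [k.+1%:R^-1 <= 1], the other the open left sides. Inside [B] the
   mean value theorem bounds the quotients by [C]. *)
pose B : set 'rV[R]_n := box (const_mx (- M - 1 - 1)) (const_mx M).
have [|||||_ _] := @dominated_convergence _ _ _ mu setT measurableT
  (fun k x => (f k x)%:E) (fun x => (partial i phi x)%:E) (fun x => (C * 1 * \1_B x)%:E).
- move=> k; apply/measurable_EFinP; apply: measurable_funM; first exact: measurable_cst.
  exact: measurable_funB.
- by apply/measurable_EFinP; exact: continuous_measurable_rV.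
- apply: aeW => x _; apply/cvg_EFin; first exact: nearW.
  have hd : (fun h => h^-1 *: ((phi \o shift x) (h *: e) - phi x)) @ 0^' --> partial i phi x.
    exact: d.
  have hk : (k.+1%:R^-1 : R) @[k --> \oo] --> (0 : R)^'.
    move=> A A0.
    have h : \forall k \near \oo, (k.+1%:R^-1 : R) != 0 -> A (k.+1%:R^-1 : R) := @cvg_harmonic R _ A0.
    by case: h => K0 _ hK; exists K0 => // k /hK /=; apply; rewrite invr_eq0.
  have := cvg_comp _ _ hk hd.
  apply: cvg_trans; apply: near_eq_cvg; near=> k.
  by rewrite /= /f invrK.
- exact: (box_integrable_cst_mul_indic C _ _ (measurable_cst _) box_integrable_cst1).
- apply: aeW => x k _; rewrite /= lee_fin indicE.
  have k0 : 0 < k.+1%:R^-1 :> R by rewrite invr_gt0.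
  have k1 : k.+1%:R^-1 <= 1 :> R by rewrite invf_le1// ler1n.
  have [xB|/negP xB] := boolP (x \in B).
    rewrite !mulr1 /f normrM ger0_norm// mulrC -ler_pdivlMr//.
    exact: partial_increment_le.
  have /existsNP[j] : ~ B x by move=> xB'; apply: xB; exact/mem_set.
  rewrite !mxE in_itv/= => /negP; rewrite negb_and -leNgt -ltNge => hx.
  have ej : 0 <= k.+1%:R^-1 * e ord0 j <= 1.
    rewrite /e mxE eqxx/=; case: (j == i); first by rewrite mulr1 (ltW k0) k1.
    by rewrite mulr0 lexx ler01.
  have big (z : R) : z <= - M - 1 \/ M < z -> M < `|z|.
    by case=> hz; [rewrite ltr_normr; apply/orP; right; lra|exact: lt_le_trans (ler_norm _)].
  rewrite /f (hs x j) ?(hs (_ + x) j) ?subrr ?mulr0 ?normr0//; apply: big.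
  + rewrite (_ : (_ *: e + x) ord0 j = k.+1%:R^-1 * e ord0 j + x ord0 j); last by rewrite !mxE.
    by case/orP: hx => hx; [left|right]; move: (k.+1%:R^-1 * _) ej hx => z; lra.
  + by case/orP: hx => hx; [left|right] => //; lra.
- rewrite (_ : [sequence _]_k = cst 0%E); last by apply/funext => k; exact: f0.
  move=> h; have /= := cvg_unique _ h (cvg_cst 0%E).
  by move=> /(_ (@ereal_hausdorff R)) ->.
Unshelve. all: by end_near. Qed.

End cube_support.

(** * Weak and classical gradients *)

Section classical_gradient.
Context {R : realType} (n : nat).
Local Notation mu := (@lebesgue_rV R n).
Implicit Types (u phi : 'rV[R]_n -> R) (x : 'rV[R]_n) (i : 'I_n).

Definition grad u x : 'rV[R]_n := \row_i partial i u x.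

Lemma test_function_continuous u : test_function u -> continuous u.
Proof. by move=> [/(_ [::])[]]. Qed.

Lemma test_function_derivable u i x : test_function u -> derivable u x (delta_mx ord0 i).
Proof. by move=> [/(_ [::])[_ /(_ i x)]]. Qed.

Lemma test_function_partial_continuous u i : test_function u -> continuous (partial i u).
Proof. by move=> [/(_ [:: i])[]]. Qed.

(** Integration by parts: [u * phi] is continuous with bounded support, so its partial derivative
    integrates to 0, and the product rule splits that integral. *)
Lemma is_weak_gradient_grad u : test_function u -> is_weak_gradient u (grad u).
Proof.
move=> tu; have [M uM] := test_function_cube_support tu.
have cu := test_function_continuous tu.
have cdu i := test_function_partial_continuous (i := i) tu.
split.
- exact: cube_support_locally_integrable cu uM.
- move=> i; under eq_fun do rewrite mxE.
  exact: cube_support_locally_integrable (cdu i) (@cube_support_partial _ _ M u i uM).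
- move=> phi tphi i; under [in RHS]eq_integral do rewrite mxE.
  have cphi := test_function_continuous tphi.
  have cdphi := test_function_partial_continuous (i := i) tphi.
  have dF x : is_derive x (delta_mx ord0 i) (fun y => u y * phi y)
      (u x * partial i phi x + partial i u x * phi x).
    have D1 : is_derive x (delta_mx ord0 i) u (partial i u x).
      by apply: DeriveDef => //; exact: test_function_derivable.
    have D2 : is_derive x (delta_mx ord0 i) phi (partial i phi x).
      by apply: DeriveDef => //; exact: test_function_derivable.
    by have := is_deriveM D1 D2; rewrite /GRing.scale/= (mulrC (phi x)).
  have pF : partial i (fun y => u y * phi y) =
      (fun x => u x * partial i phi x + partial i u x * phi x).
    by apply/funext => x; rewrite /partial (derive_val (is_derive := dF x)).
  have cM (f g : 'rV[R]_n -> R) : continuous f -> continuous g -> continuous (fun x => f x * g x).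
    by move=> cf cg x; apply: (@continuousM _ _ f g); [exact: cf|exact: cg].
  have sM (f g : 'rV[R]_n -> R) : cube_support M f -> cube_support M (fun x => f x * g x).
    by move=> sf x j hx; rewrite (sf x j hx) mul0r.
  have h0 : (\int[mu]_x (partial i (fun y => u y * phi y) x)%:E = 0)%E.
  { apply: (@integral_partial_eq0 _ _ M).
    + exact: cM.
    + exact: sM.
    + by move=> y; case: (dF y).
    + by rewrite pF => x; apply: (@continuousD _ _ _ (fun x => u x * partial i phi x)); apply: cM. }
  have i1 : mu.-integrable setT (fun x => (u x * partial i phi x)%:E).
    exact: (cube_support_integrable (cM _ _ cu cdphi) (sM _ _ uM)).
  have i2 : mu.-integrable setT (fun x => (partial i u x * phi x)%:E).
    apply: (cube_support_integrable (cM _ _ (cdu i) cphi) (M := M)); apply: sM.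
    exact: cube_support_partial.
  have h1 : (\int[mu]_x ((u x * partial i phi x)%:E + (partial i u x * phi x)%:E) = 0)%E.
    by rewrite -h0; apply: eq_integral => x _; rewrite -EFinD pF.
  move: h1; rewrite integralD//.
  rewrite -(fineK (integrable_fin_num measurableT i1)) -(fineK (integrable_fin_num measurableT i2)).
  by rewrite -EFinD -EFinN => -[] /eqP; rewrite addr_eq0 => /eqP ->.
Qed.

Lemma weak_gradient_unique u (g g' : 'rV[R]_n -> 'rV[R]_n) :
  is_weak_gradient u g -> is_weak_gradient u g' -> {ae mu, forall x, g x = g' x}.
Proof.
move=> [_ lg hg] [_ lg' hg'].
have key i : {ae mu, forall x, g x ord0 i - g' x ord0 i = 0}.
{ have [mg _] := lg i; have [mg' _] := lg' i.
  have ig := locally_integrable_box (lg i); have ig' := locally_integrable_box (lg' i).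
  apply: fundamental_lemma.
  - exact: measurable_funB.
  - move=> a b; have := integrableB (measurable_box a b) (ig a b) (ig' a b).
    by apply: eq_integrable => //; exact: measurable_box.
  - move=> k a b; have tb := test_function_box_bump k a b.
    have mb := measurable_test_function tb.
    have b1 := box_bump_le1 k a b; have b0 := @box_bump_out _ _ k a b.
    have i1 := box_integrable_mul mg ig mb b1 b0.
    have i2 := box_integrable_mul mg' ig' mb b1 b0.
    under eq_integral do rewrite mulrBl EFinB.
    rewrite integralB//; have := hg _ tb i; rewrite (hg' _ tb i) => /eqP.
    by rewrite eqe_opp => /eqP <-; rewrite subee//; exact: integrable_fin_num. }
(* Quantifying over natural numbers instead of ['I_n] lets [ae_foralln] merge the null sets of the
   coordinates. *)
have allkey : {ae mu, forall x, forall k : nat, forall i : 'I_n, val i = k -> g x ord0 i = g' x ord0 i}.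
  apply: ae_foralln => k; have [kn|nk] := ltnP k n.
    have := key (Ordinal kn); apply: filterS => x /eqP; rewrite subr_eq0 => /eqP h i ik.
    by rewrite (_ : i = Ordinal kn)//; exact: val_inj.
  by apply: aeW => x i ik; have := ltn_ord i; rewrite ik ltnNge nk.
by apply: filterS allkey => x h; apply/rowP => i; exact: h.
Qed.

Lemma weak_gradientP u : weakly_differentiable u -> is_weak_gradient u (weak_gradient u).
Proof. by move=> [g ug]; apply: (@xgetPex _ (fun=> 0) [set g | is_weak_gradient u g]); exists g. Qed.

(** The energy involves a chosen representative; uniqueness allows it to be estimated through the
    classical gradient of the competitors. *)
Lemma weak_gradient_grad u : test_function u -> {ae mu, forall x, weak_gradient u x = grad u x}.
Proof.
move=> tu; have wu := is_weak_gradient_grad tu.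
by apply: (weak_gradient_unique (u := u)) => //; apply: weak_gradientP; exists (grad u).
Qed.

Lemma measurable_euclidean_norm (g : 'rV[R]_n -> 'rV[R]_n) :
  (forall i, measurable_fun setT (fun x => g x ord0 i)) ->
  measurable_fun setT (fun x => euclidean_norm (g x)).
Proof.
move=> mg; rewrite /euclidean_norm.
apply: (measurableT_comp (f := @Num.sqrt R)).
  by apply: continuous_measurable_fun; exact: sqrt_continuous.
apply: measurable_sum => i; apply: measurable_funX; exact: mg.
Qed.

Lemma measurable_gradient_norm u : weakly_differentiable u -> measurable_fun setT (gradient_norm u).
Proof.
move=> /weak_gradientP[_ lg _]; apply: measurable_euclidean_norm => i.
by have [] := lg i.
Qed.

Lemma euclidean_norm_ge0 (v : 'rV[R]_n) : 0 <= euclidean_norm v.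
Proof. exact: sqrtr_ge0. Qed.

Lemma coord_le_euclidean_norm (v : 'rV[R]_n) i : `|v ord0 i| <= euclidean_norm v.
Proof.
rewrite -sqrtr_sqr ler_sqrt; last by rewrite sumr_ge0// => j _; exact: sqr_ge0.
by rewrite (bigD1 i)//= lerDl sumr_ge0// => j _; exact: sqr_ge0.
Qed.

Lemma euclidean_norm_le (v : 'rV[R]_n) (C : R) : 0 <= C -> (forall i, `|v ord0 i| <= C) ->
  euclidean_norm v <= Num.sqrt n%:R * C.
Proof.
move=> C0 hv; rewrite -[C in leRHS]ger0_norm// -sqrtr_sqr -sqrtrM//.
rewrite ler_sqrt; last by rewrite mulr_ge0// sqr_ge0.
apply: (@le_trans _ _ (\sum_(i < n) C ^+ 2)); last by rewrite sumr_const card_ord mulr_natl.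
by apply: ler_sum => i _; rewrite -real_normK ?num_real// lerXn2r ?nnegrE.
Qed.

Lemma euclidean_norm0 : euclidean_norm (0 : 'rV[R]_n) = 0.
Proof. by rewrite /euclidean_norm big1 ?sqrtr0// => i _; rewrite mxE expr0n. Qed.

End classical_gradient.

(** * Dilated competitors *)

Section norm_bounds.
Context {R : realType} (n : nat).
Local Notation mu := (@lebesgue_rV R n).

Lemma integral_powR_le (f : 'rV[R]_n -> R) (a b : 'rV[R]_n) (C r : R) : 0 < r -> 0 <= C ->
  measurable_fun setT f -> {ae mu, forall x, `|f x| <= C /\ (~ box a b x -> f x = 0)} ->
  (\int[mu]_x (`|f x| `^ r)%:E <= (C `^ r)%:E * mu (box a b))%E.
Proof.
move=> r0 C0 mf hf; have mB := measurable_box a b.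
have -> : mu (box a b) = (\int[mu]_x (\1_(box a b) x)%:E)%E by rewrite integral_indic// setIT.
rewrite -ge0_integralZl_EFin ?powR_ge0//; last by apply/measurable_EFinP; exact: measurable_indic.
apply: ae_ge0_le_integral => //.
- exact: measurable_norm_powR.
- by move=> x _; rewrite -EFinM lee_fin mulr_ge0 ?powR_ge0.
- by apply: emeasurable_funM; [exact: measurable_cst|apply/measurable_EFinP; exact: measurable_indic].
- apply: filterS hf => x [fC f0] _; rewrite -EFinM lee_fin indicE.
  have [xB|xB] := pselect (box a b x); last first.
    by rewrite f0// normr0 powR0 ?gt_eqF// mulr_ge0 ?powR_ge0.
  by rewrite mem_set// mulr1; apply: ge0_ler_powR; rewrite ?nnegrE ?(ltW r0).
Qed.

Lemma integral_powR_ge (f : 'rV[R]_n -> R) (a b : 'rV[R]_n) (D r : R) : 0 < r -> 0 <= D ->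
  measurable_fun setT f -> (forall x, box a b x -> D <= `|f x|) ->
  ((D `^ r)%:E * mu (box a b) <= \int[mu]_x (`|f x| `^ r)%:E)%E.
Proof.
move=> r0 D0 mf hf; have mB := measurable_box a b.
have -> : mu (box a b) = (\int[mu]_x (\1_(box a b) x)%:E)%E by rewrite integral_indic// setIT.
rewrite -ge0_integralZl_EFin ?powR_ge0//; last by apply/measurable_EFinP; exact: measurable_indic.
apply: ge0_le_integral => //.
- by move=> x _; rewrite -EFinM lee_fin mulr_ge0 ?powR_ge0.
- by apply: emeasurable_funM; [exact: measurable_cst|apply/measurable_EFinP; exact: measurable_indic].
- exact: measurable_norm_powR.
- move=> x _; rewrite -EFinM lee_fin indicE.
  have [xB|xB] := pselect (box a b x); last by rewrite memNset// mulr0 powR_ge0.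
  by rewrite mem_set// mulr1; apply: ge0_ler_powR; rewrite ?nnegrE ?(ltW r0)// hf.
Qed.

End norm_bounds.

Section competitor.
Context {R : realType} (n : nat).
Hypothesis n0 : (0 < n)%N.
Local Notation mu := (@lebesgue_rV R n).

Local Notation eta := (bump 0 (0 : R) 1).

Lemma vanishes_off_bounded (M : R) (f : R -> R) : continuous f -> vanishes_off M f ->
  exists2 C, 0 < C & forall x, `|f x| <= C.
Proof.
move=> cf f0.
have : compact (f @` `[- M, M]).
  by apply: continuous_compact; [exact: continuous_subspaceT|exact: segment_compact].
move/compact_bounded => [C [Creal hC]].
exists (`|C| + 1); first by rewrite ltr_wpDl.
move=> x; have [xM|xM] := leP `|x| M; last by rewrite f0// normr0 addr_ge0.
apply: hC; first by rewrite (le_lt_trans (ler_norm C))// ltrDl.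
by exists x => //=; rewrite in_itv/= -ler_norml.
Qed.

Lemma bump_lower_bound : exists2 d : R, 0 < d & forall x : R, 2^-1 <= x <= 1 -> d <= eta x.
Proof.
(* For [1/2 <= x <= 1] the arguments of the two factors [flat 1] are [x >= 1/2] and [2 - x >= 1]. *)
exists (expR (-2) * expR (-1)); first by rewrite mulr_gt0 ?expR_gt0.
move=> x /andP[x1 x2]; have x0 : 0 < x by apply: lt_le_trans x1; rewrite invr_gt0.
rewrite /bump !flat1E subr0 mul1r x0 exp1n mul1r.
have y0 : 0 < 1 - x + 1 by lra.
rewrite y0; apply: ler_pM; rewrite ?expR_ge0// ler_expR lerN2.
  by rewrite -[2]invrK lef_pV2 ?posrE// invr_gt0.
by rewrite invf_le1//; lra.
Qed.

(** [cst a t] and [+ 0] match the shapes of [smooth1_cst] and [smooth1_affine]. The amplitude sits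
    in each factor, so the product has amplitude [a ^+ n]. *)
Definition profile (a l t : R) : R := cst a t * eta (l^-1 * t + 0).

Definition competitor (a l : R) : 'rV[R]_n -> R := prod_fun (fun=> profile a l).

Lemma smooth1_profile a l : smooth1 (profile a l).
Proof. by apply: smooth1M; [exact: smooth1_cst|apply: smooth1_affine; exact: smooth1_bump]. Qed.

Lemma vanishes_off_profile a l : 0 < l -> vanishes_off (2 * l) (profile a l).
Proof.
move=> l0 t ht; rewrite /profile addr0 bump_out ?mulr0//.
apply/negP => /andP[h1 h2]; move: ht; apply/negP; rewrite -leNgt.
have t0 : 0 < t by move: h1; rewrite pmulr_rgt0// invr_gt0.
by rewrite gtr0_norm//; move: h2; rewrite mulrC ltr_pdivrMr// => /ltW; rewrite (_ : 1 + 1 = 2)//; ring.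
Qed.

Lemma test_function_competitor a l : 0 < l -> test_function (competitor a l).
Proof.
move=> l0; apply: test_function_prod_fun => i; first exact: smooth1_profile.
exact: vanishes_off_profile.
Qed.

Lemma profile_le a l t : 0 <= a -> 0 <= profile a l t <= a.
Proof.
by move=> a0; rewrite mulr_ge0 ?bump_ge0//= ler_piMr// bump_le1.
Qed.

Lemma competitor_le a l x : 0 <= a -> 0 <= competitor a l x <= a ^+ n.
Proof.
move=> a0; rewrite prodr_ge0/= => [|i _]; last by case/andP: (profile_le l (x ord0 i) a0).
rewrite -[n in leRHS]card_ord -prodr_const; apply: ler_prod => i _; exact: profile_le.
Qed.

Lemma competitorE a l x : competitor a l x = a ^+ n * competitor 1 l x.
Proof.
rewrite /competitor /prod_fun -[n in a ^+ n]card_ord -prodr_const -big_split/=.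
by apply: eq_bigr => i _; rewrite /profile/= mul1r.
Qed.

Lemma competitor_ge d a l x : 0 <= d -> (forall t : R, 2^-1 <= t <= 1 -> d <= eta t) -> 0 <= a -> 0 < l ->
  box (const_mx (l / 2)) (const_mx l) x -> (a * d) ^+ n <= competitor a l x.
Proof.
move=> d0 hd a0 l0 xB; rewrite -[n in leLHS]card_ord -prodr_const; apply: ler_prod => i _.
rewrite mulr_ge0//= /profile addr0 ler_wpM2l// hd//.
have := xB i; rewrite !mxE in_itv/= => /andP[/ltW h1 h2].
by rewrite ler_pdivlMl// h1 ler_pdivrMl// mulr1 h2.
Qed.

Lemma cube_support_competitor a l : 0 < l -> cube_support (2 * l) (competitor a l).
Proof.
move=> l0 x i hx; apply/eqP; rewrite prodf_seq_eq0; apply/hasP; exists i.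
  by rewrite mem_index_enum.
by rewrite /= vanishes_off_profile.
Qed.

Lemma partial_competitor_le a l L x i : 0 <= a -> 0 < l -> (forall t, `|derive1 eta t| <= L) ->
  `|partial i (competitor a l) x| <= a ^+ n * L / l.
Proof.
move=> a0 l0 hL.
have D : is_derive x (delta_mx ord0 i) (competitor a l) _ :=
  is_derive_prod_fun (@smooth1_derivable _ _ (x ord0 i) (smooth1_profile a l)).
rewrite /partial (derive_val (is_derive := D)) prod_fun_update.
have De : is_derive (x ord0 i) 1 (profile a l) (a * (derive1 eta (l^-1 * x ord0 i + 0) * l^-1)).
  have D1 : is_derive (x ord0 i) 1 (fun t => eta (l^-1 * t + 0)) (derive1 eta (l^-1 * x ord0 i + 0) * l^-1).
    apply: (@is_derive1_comp _ eta (fun t => l^-1 * t + 0)); last exact: is_derive_affine.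
    rewrite derive1E; apply: DeriveDef => //; apply: smooth1_derivable; exact: smooth1_bump.
  have := is_deriveM (is_derive_cst a (x ord0 i) 1) D1.
  by rewrite scaler0 addr0.
rewrite derive1E (derive_val (is_derive := De)) normrM normrM (ger0_norm a0) normrM.
rewrite [`|l^-1|]gtr0_norm ?invr_gt0//.
apply: (@le_trans _ _ (a * (L * l^-1) * a ^+ n.-1)).
  apply: ler_pM => //; first by rewrite !mulr_ge0// invr_ge0 ltW.
    by rewrite ler_wpM2l// ler_wpM2r// invr_ge0 ltW.
  rewrite normr_prod -(_ : \prod_(j | j != i) a = a ^+ n.-1); last first.
    by rewrite prodr_const cardC1 card_ord.
  by apply: ler_prod => j _; rewrite normr_ge0/= ger0_norm; case/andP: (profile_le l (x ord0 j) a0).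
by case: n n0 => // k _; rewrite exprS/= le_eqVlt; apply/orP; left; apply/eqP; ring.
Qed.

Lemma competitor_exists : exists C D : R, [/\ 0 < C, 0 < D & forall c l : R, 0 < c -> 0 < l ->
  exists u : 'rV[R]_n -> R, [/\ test_function u,
    (\int[mu]_x (`|u x| `^ 2)%:E = (c ^+ 2)%:E)%E,
    forall r, 0 < r -> (\int[mu]_x (`|u x| `^ r)%:E < +oo)%E,
    forall r, 0 < r -> (\int[mu]_x (`|gradient_norm u x| `^ r)%:E <=
      ((C * c) `^ r * 5 ^+ n * l `^ (n%:R - r * (n%:R / 2 + 1)))%:E)%E &
    forall r, 0 < r -> (((D * c) `^ r / 2 ^+ n * l `^ (n%:R - r * (n%:R / 2)))%:E <=
      \int[mu]_x (`|u x| `^ r)%:E)%E]].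
Proof.
have [d d0 hd] := bump_lower_bound.
have [L L0 hL] : exists2 L, 0 < L & forall t, `|derive1 eta t| <= L.
  apply: (@vanishes_off_bounded (`|0| + `|1| + 1)).
    by apply: smooth1_continuous; apply: smooth1_derive1; exact: smooth1_bump.
  by apply: vanishes_off_derive1; exact: bump_vanishes_off.
have nR0 : 0 < n%:R :> R by rewrite ltr0n.
(* Comes from the lower bound on the mass: [V]^ (- 2^-1) <= K * l [^ (- (n%:R / 2))]. *)
pose K := (d ^+ n)^-1 * 2 `^ (n%:R / 2).
have K0 : 0 < K by rewrite mulr_gt0 ?invr_gt0 ?exprn_gt0 ?powR_gt0.
(* The square root passes from coordinates to the Euclidean norm; the power of 5 comes from the
   upper bound [(5 * l) ^+ n] on [V]. *)
exists (Num.sqrt n%:R * L * K), (d ^+ n * 5 `^ (- (n%:R / 2))); split;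
  [by rewrite mulr_gt0// mulr_gt0// sqrtr_gt0|by rewrite mulr_gt0 ?exprn_gt0 ?powR_gt0|].
move=> c l c0 l0.
(* The support satisfies [|x_i| <= 2 l]; starting the box at [- 3 * l] allows for its open left
   sides. *)
have vol : mu (box (const_mx (- 3 * l)) (const_mx (2 * l)) : set 'rV[R]_n) = ((5 * l) ^+ n)%:E.
  rewrite lebesgue_box => [|i]; last by rewrite !mxE; lra.
  under eq_bigr do rewrite !mxE; rewrite prodr_const card_ord.
  by congr ((_ ^+ _)%:E); ring.
have vol2 : mu (box (const_mx (l / 2)) (const_mx l) : set 'rV[R]_n) = ((l / 2) ^+ n)%:E.
  rewrite lebesgue_box => [|i]; last by rewrite !mxE; lra.
  under eq_bigr do rewrite !mxE; rewrite prodr_const card_ord.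
  by congr ((_ ^+ _)%:E); field.
have out (phi : 'rV[R]_n -> R) x : cube_support (2 * l) phi ->
    ~ box (const_mx (- 3 * l)) (const_mx (2 * l)) x -> phi x = 0.
  move=> hs /existsNP[i]; rewrite !mxE in_itv/= => /negP; rewrite negb_and -leNgt -ltNge => hx.
  apply: (hs x i); rewrite ltNge ler_norml; apply/negP => /andP[h1 h2].
  by case/orP: hx; lra.
have mc a : measurable_fun setT (competitor a l).
  by apply: measurable_test_function; exact: test_function_competitor.
have ae_c a : 0 <= a -> {ae mu, forall x, `|competitor a l x| <= a ^+ n /\
    (~ box (const_mx (- 3 * l)) (const_mx (2 * l)) x -> competitor a l x = 0)}.
  move=> a0; apply: aeW => x; have /andP[h1 h2] := competitor_le l x a0.
  by rewrite ger0_norm//; split => // xB; exact: (out _ _ (cube_support_competitor a l0) xB).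
have upper a r : 0 <= a -> 0 < r ->
    (\int[mu]_x (`|competitor a l x| `^ r)%:E <= ((a ^+ n) `^ r * (5 * l) ^+ n)%:E)%E.
  move=> a0 r0; rewrite EFinM -vol.
  by apply: integral_powR_le => //; [exact: exprn_ge0|exact: ae_c].
have lower a r : 0 <= a -> 0 < r ->
    ((((a * d) ^+ n) `^ r * (l / 2) ^+ n)%:E <= \int[mu]_x (`|competitor a l x| `^ r)%:E)%E.
  move=> a0 r0; rewrite EFinM -vol2.
  apply: integral_powR_ge => //; first by rewrite exprn_ge0// mulr_ge0// ltW.
  move=> x xB; apply: le_trans (ler_norm _).
  exact: competitor_ge (ltW d0) hd a0 l0 xB.
pose V := fine (\int[mu]_x (`|competitor 1 l x| `^ 2)%:E)%E.
have VE : (\int[mu]_x (`|competitor 1 l x| `^ 2)%:E = V%:E)%E.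
  rewrite /V fineK// ge0_fin_numE; last by apply: integral_ge0 => x _; rewrite lee_fin powR_ge0.
  exact: le_lt_trans (upper 1 2 ler01 (ltr0Sn _ _)) (ltry _).
have Vup : V <= (5 * l) ^+ n.
  rewrite -lee_fin -VE; apply: le_trans (upper 1 2 ler01 (ltr0Sn _ _)) _.
  by rewrite expr1n powR1 mul1r.
have Vlow : (d ^+ n) `^ 2 * (l / 2) ^+ n <= V.
  by rewrite -lee_fin -VE; have := lower 1 2 ler01 (ltr0Sn _ _); rewrite mul1r.
have V0 : 0 < V.
  by apply: lt_le_trans Vlow; rewrite mulr_gt0 ?powR_gt0 ?exprn_gt0// divr_gt0.
(* The amplitude that gives mass [c ^+ 2]; [a] is its [n]-th root because each of the [n] factors
   carries [a]. *)
pose A := c * V `^ (- 2^-1).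
have A0 : 0 < A by rewrite mulr_gt0 ?powR_gt0.
pose a := A `^ n%:R^-1.
have a0 : 0 <= a by exact: powR_ge0.
have aA : a ^+ n = A.
  by rewrite -powR_mulrn ?powR_ge0// -powRrM mulVf ?gt_eqF// powRr1// ltW.
have half (y : R) : 0 <= y -> (y ^+ n) `^ 2^-1 = y `^ (n%:R / 2).
  by move=> y0; rewrite -powR_mulrn// -powRrM.
have V1h : ((d ^+ n) `^ 2 * (l / 2) ^+ n) `^ 2^-1 = K^-1 * l `^ (n%:R / 2).
  have l20 : 0 <= l / 2 by rewrite divr_ge0// ltW.
  have dn0 : 0 <= d ^+ n by rewrite exprn_ge0// ltW.
  rewrite powRM ?powR_ge0 ?exprn_ge0// -powRrM divff// powRr1// half//.
  have h2 (z : R) : 2^-1 `^ z = (2 `^ z)^-1.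
    by rewrite -(powR_inv1 (ler0n _ 2)) -powRrM mulN1r powRN.
  by rewrite powRM ?invr_ge0 ?(ltW l0)// h2 /K invfM invrK; ring.
have Aup : A <= K * c * l `^ (- (n%:R / 2)).
  rewrite /A (mulrC K) -mulrA ler_wpM2l ?(ltW c0)// !powRN -[K]invrK -invfM -V1h.
  have V10 : 0 < (d ^+ n) `^ 2 * (l / 2) ^+ n.
    by rewrite mulr_gt0 ?powR_gt0 ?exprn_gt0// divr_gt0.
  rewrite lef_pV2 ?posrE ?powR_gt0//.
  by apply: ge0_ler_powR; rewrite ?nnegrE ?invr_ge0 ?(ltW V0) ?(ltW V10).
have Alow : 5 `^ (- (n%:R / 2)) * c * l `^ (- (n%:R / 2)) <= A.
  rewrite /A (mulrC (5 `^ _)) -mulrA ler_wpM2l ?(ltW c0)// -powRM ?(ltW l0)// !powRN.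
  have l50 : 0 < 5 * l by rewrite mulr_gt0.
  rewrite lef_pV2 ?posrE ?powR_gt0// -half ?(ltW l50)//.
  by apply: ge0_ler_powR; rewrite ?nnegrE ?invr_ge0 ?exprn_ge0 ?(ltW V0) ?(ltW l50).
have ln : l ^+ n = l `^ n%:R by rewrite powR_mulrn// ltW.
have tu := test_function_competitor a l0.
exists (competitor a l); split => //.
- under eq_integral do rewrite competitorE aA normrM powRM// EFinM.
  rewrite ge0_integralZl_EFin ?powR_ge0//; last by apply: measurable_norm_powR; exact: mc.
  rewrite VE -EFinM; congr (_%:E).
  rewrite gtr0_norm// powR_mulrn ?(ltW A0)// /A exprMn -[X in _ * X * _]powR_mulrn ?powR_ge0//.
  by rewrite -powRrM mulNr mulVf// powR_inv1 ?(ltW V0)// mulrVK ?unitfE ?gt_eqF.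
- by move=> r r0; apply: le_lt_trans (upper a r a0 r0) (ltry _).
- move=> r r0.
  have g0 : 0 <= Num.sqrt n%:R * (A * L / l).
    by rewrite mulr_ge0 ?sqrtr_ge0// divr_ge0 ?(ltW l0)// mulr_ge0 ?(ltW A0) ?(ltW L0).
  apply: (@le_trans _ _ (((Num.sqrt n%:R * (A * L / l)) `^ r)%:E * ((5 * l) ^+ n)%:E)%E).
  { rewrite -vol; apply: integral_powR_le => //.
      by apply: measurable_gradient_norm; exists (grad (competitor a l)); exact: is_weak_gradient_grad.
    have := weak_gradient_grad tu; apply: filterS => x gx.
    rewrite /gradient_norm gx; split.
      rewrite ger0_norm ?euclidean_norm_ge0//; apply: euclidean_norm_le.
        by rewrite divr_ge0 ?(ltW l0)// mulr_ge0 ?(ltW A0) ?(ltW L0).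
      by move=> i; rewrite mxE -aA; exact: partial_competitor_le.
    move=> xB; rewrite (_ : grad _ x = 0) ?euclidean_norm0//.
    apply/rowP => i; rewrite !mxE; apply: (out _ _ _ xB).
    by apply: cube_support_partial; exact: cube_support_competitor. }
  rewrite -EFinM lee_fin.
  have le1 : Num.sqrt n%:R * (A * L / l) <= Num.sqrt n%:R * L * K * c * l `^ (- (n%:R / 2 + 1)).
    rewrite opprD powRD ?(gt_eqF l0) ?implybT// powR_inv1 ?(ltW l0)//.
    rewrite [leRHS](_ : _ = Num.sqrt n%:R * (K * c * l `^ (- (n%:R / 2)) * L / l)); last by ring.
    rewrite ler_wpM2l ?sqrtr_ge0// ler_wpM2r ?invr_ge0 ?(ltW l0)//.
    by rewrite ler_wpM2r ?(ltW L0).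
  have Cc0 : 0 <= Num.sqrt n%:R * L * K * c.
    by rewrite mulr_ge0 ?(ltW c0)// mulr_ge0 ?(ltW K0)// mulr_ge0 ?(ltW L0)// sqrtr_ge0.
  apply: (@le_trans _ _ ((Num.sqrt n%:R * L * K * c * l `^ (- (n%:R / 2 + 1))) `^ r * (5 * l) ^+ n)).
    apply: ler_wpM2r; first by apply: exprn_ge0; rewrite mulr_ge0// ltW.
    apply: ge0_ler_powR => //; first exact: ltW.
    by rewrite nnegrE mulr_ge0 ?powR_ge0.
  rewrite (powRM _ Cc0 (powR_ge0 _ _)) -powRrM exprMn ln.
  have -> : n%:R - r * (n%:R / 2 + 1) = - (n%:R / 2 + 1) * r + n%:R by ring.
  by rewrite powRD ?(gt_eqF l0) ?implybT// le_eqVlt; apply/orP; left; apply/eqP; ring.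
- move=> r r0; apply: le_trans (lower a r a0 r0); rewrite lee_fin.
  have Dc0 : 0 <= d ^+ n * 5 `^ (- (n%:R / 2)) * c.
    by rewrite mulr_ge0 ?(ltW c0)// mulr_ge0 ?powR_ge0// exprn_ge0// ltW.
  have le1 : d ^+ n * 5 `^ (- (n%:R / 2)) * c * l `^ (- (n%:R / 2)) <= (a * d) ^+ n.
    rewrite exprMn aA [leRHS]mulrC -!mulrA ler_wpM2l ?exprn_ge0 ?(ltW d0)//.
    by rewrite mulrA.
  apply: (@le_trans _ _ ((d ^+ n * 5 `^ (- (n%:R / 2)) * c * l `^ (- (n%:R / 2))) `^ r * (l / 2) ^+ n)).
    rewrite (powRM _ Dc0 (powR_ge0 _ _)) -powRrM exprMn exprVn ln.
    have -> : n%:R - r * (n%:R / 2) = - (n%:R / 2) * r + n%:R by ring.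
    by rewrite powRD ?(gt_eqF l0) ?implybT// le_eqVlt; apply/orP; left; apply/eqP; ring.
  rewrite ler_wpM2r ?exprn_ge0 ?divr_ge0 ?(ltW l0)//.
  apply: ge0_ler_powR => //; first exact: ltW.
    by rewrite nnegrE mulr_ge0 ?powR_ge0.
  by rewrite nnegrE exprn_ge0// mulr_ge0// ltW.
Qed.

End competitor.

(** * The energy on the sphere *)

Section energy.
Context {R : realType} (n : nat).
Local Notation mu := (@lebesgue_rV R n).

Lemma poweR_normL (r : R) (f : 'rV[R]_n -> R) : 0 < r ->
  (normL r f `^ r = \int[mu]_x (`|f x| `^ r)%:E)%E.
Proof. by move=> r0; rewrite /normL poweR_Lnorm// gt_eqF. Qed.

Lemma LfunP_integral (r : R) (f : 'rV[R]_n -> R) : 0 < r ->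
  f \in Lfun mu r%:E <->
  measurable_fun setT f /\ (\int[mu]_x (`|f x| `^ r)%:E < +oo)%E.
Proof.
move=> r0; split.
  move=> /andP[]; rewrite !inE/= => mf; rewrite /finite_norm => foo; split => //.
  by rewrite -poweR_normL// poweR_lty.
move=> [mf foo]; apply/andP; split; rewrite inE//= /finite_norm.
by rewrite (@lty_poweRy _ _ r) ?gt_eqF//; rewrite -/(normL r f) poweR_normL.
Qed.

Lemma ge0_integral_fineK (f : 'rV[R]_n -> R) (r : R) :
  (\int[mu]_x (`|f x| `^ r)%:E < +oo)%E ->
  exists2 v : R, 0 <= v & (\int[mu]_x (`|f x| `^ r)%:E = v%:E)%E.
Proof.
have h0 : (0 <= \int[mu]_x (`|f x| `^ r)%:E)%E.
  by apply: integral_ge0 => x _; rewrite lee_fin powR_ge0.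
move=> foo; exists (fine (\int[mu]_x (`|f x| `^ r)%:E)); first exact: fine_ge0.
by rewrite fineK// ge0_fin_numE.
Qed.

Variables (q p : R).
Hypotheses (qn : 1 < q < n%:R) (pE : p = q * (1 + 2 / n%:R)) (p2 : 2 < p)
  (ps : p < sobolev_exponent n q).
Local Notation s := (sobolev_exponent n q).

Let q0 : 0 < q. Proof. by case/andP: qn => q1 _; exact: lt_trans q1. Qed.
Let qltn : q < n%:R. Proof. by case/andP: qn. Qed.
Let n0 : 0 < n%:R :> R. Proof. exact: lt_trans qltn. Qed.
Let p0 : 0 < p. Proof. exact: lt_trans p2. Qed.
Let s0 : 0 < s. Proof. exact: lt_trans ps. Qed.

Lemma energyE (u : 'rV[R]_n -> R) (a2 aq b : R) :
  (\int[mu]_x (`|gradient_norm u x| `^ 2)%:E = a2%:E)%E ->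
  (\int[mu]_x (`|gradient_norm u x| `^ q)%:E = aq%:E)%E ->
  (\int[mu]_x (`|u x| `^ p)%:E = b%:E)%E ->
  energy q p u = (2^-1 * a2 + q^-1 * aq - p^-1 * b)%:E.
Proof. by move=> h2 hq hp; rewrite /energy !poweR_normL// h2 hq hp. Qed.

(** Membership in the sphere makes the gradient terms finite, and finiteness of the L^p norm comes
    with the Gagliardo-Nirenberg inequality. The energy of each competitor is therefore a real
    number. *)
Lemma sphere_energy (c : R) (u : 'rV[R]_n -> R) : 0 < c -> sphere q c u ->
  exists a2 aq b : R, [/\ 0 <= a2, 0 <= aq, 0 <= b,
    (\int[mu]_x (`|u x| `^ p)%:E = b%:E)%E /\
    b <= gn_cst n q p s * (c ^+ 2) `^ (q / n%:R) * aq &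
    energy q p u = (2^-1 * a2 + q^-1 * aq - p^-1 * b)%:E].
Proof.
move=> c0 [[[uL2 [wd /(LfunP_integral _ (ltr0Sn _ 1))[mg g2]]]]].
move=> [/(LfunP_integral _ s0)[mu_ us] [_ /(LfunP_integral _ q0)[_ gq]]].
rewrite poweR_normL// => u2.
have [a2 a20 a2E] := ge0_integral_fineK g2.
have [aq aq0 aqE] := ge0_integral_fineK gq.
have [S S0 SE] := ge0_integral_fineK us.
have c20 : 0 < c ^+ 2 by exact: exprn_gt0.
have hG i : (\int[mu]_x (`|weak_gradient u x ord0 i| `^ q)%:E <= aq%:E)%E.
{ have [_ /(_ i)[mgi _] _] := weak_gradientP wd.
  rewrite -aqE; apply: ge0_le_integral => //.
  - exact: measurable_norm_powR.
  - exact: measurable_norm_powR.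
  - move=> x _; rewrite lee_fin; apply: ge0_ler_powR; rewrite ?nnegrE ?(ltW q0)//.
    by rewrite [leRHS]ger0_norm ?euclidean_norm_ge0// coord_le_euclidean_norm. }
have usS : (\int[mu]_x (`|u x| `^ s)%:E <= S%:E)%E by rewrite SE.
have GN := gagliardo_nirenberg qn pE erefl p2 ps (weak_gradientP wd) c20 u2 usS aq0 hG.
have [b b0 bE] := ge0_integral_fineK (le_lt_trans GN (ltry _)).
exists a2, aq, b; split => //; last exact: energyE.
by split => //; rewrite -lee_fin -bE.
Qed.

(** The negative term is at most [p^-1 * k] times |grad u|_q^q, and the smallness condition says
    [p^-1 * k < q^-1]. *)
Lemma small_mass_energy (c : R) (u : 'rV[R]_n -> R) : 0 < c ->
  q * (gn_cst n q p s * (c ^+ 2) `^ (q / n%:R)) < p -> sphere q c u -> (0 < energy q p u)%E.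
Proof.
move=> c0 hc su; have [a2 [aq [b [a20 aq0 b0 [bE hb] ->]]]] := sphere_energy c0 su.
set k := gn_cst n q p s * _ in hc hb.
have pb : p^-1 * b <= p^-1 * k * aq by rewrite -mulrA ler_wpM2l// invr_ge0 ltW.
have kq : p^-1 * k < q^-1 by rewrite ltr_pdivrMl// ltr_pdivlMr// mulrC.
rewrite lte_fin.
have [aq00|aqn0] := eqVneq aq 0; last first.
  have : p^-1 * k * aq < q^-1 * aq by rewrite ltr_pM2r// lt_def aqn0.
  by have : 0 <= 2^-1 * a2 by [rewrite mulr_ge0]; lra.
(* With a vanishing gradient term the comparison is no longer strict, but the L^p norm is then 0 as
   well, which contradicts the mass. *)
exfalso; move: hb; rewrite aq00 mulr0 => hb.
have b00 : b = 0 by apply/eqP; rewrite eq_le hb b0.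
move: su => [[[/(LfunP_integral _ (ltr0Sn _ 1))[mu_ _] _] _]].
rewrite poweR_normL// => u2.
have mup : measurable_fun setT (fun x => (`|u x| `^ p)%:E) by exact: measurable_norm_powR.
have ue : ae_eq mu setT (fun x => (`|u x| `^ p)%:E) (cst 0%E).
  apply/(ae_eq_integral_abs _ measurableT mup).
  transitivity b%:E; last by rewrite b00.
  by rewrite -bE; apply: eq_integral => x _; rewrite gee0_abs// lee_fin powR_ge0.
have : (\int[mu]_x (`|u x| `^ 2)%:E = 0)%E.
{ transitivity (\int[mu]_x (cst 0 x : \bar R))%E; last by rewrite integral0.
  apply: ae_eq_integral => //.
  - exact: measurable_norm_powR.
  - apply: filterS ue => x /= /(_ I) [] /eqP; rewrite powR_eq0 => /andP[/eqP -> _] _.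
    by rewrite powR0. }
by rewrite u2 => -[] /eqP; rewrite expf_eq0/= (gt_eqF c0).
Qed.

Lemma sphere_energy_Ny (c : R) (u : 'rV[R]_n -> R) : 0 < c -> sphere q c u -> energy q p u != -oo%E.
Proof. by move=> c0 su; have [a2 [aq [b [_ _ _ _ ->]]]] := sphere_energy c0 su. Qed.

(** The common decay exponent of the gradient term in L^q and of the L^p term: [q (n/2 + 1) - n] and
    [p n/2 - n] coincide for this [p]. *)
Local Notation beta := (n%:R * p / 2 - n%:R).

(** The terms in [c]^ q[and]c [^ p] carry the same power of [l], so the mass alone decides the sign
    of their sum. *)
Lemma competitor_energy : exists C1 C2 C3 : R, [/\ 0 < C1, 0 < C2, 0 < C3 & forall c l : R, 0 < c -> 0 < l ->
  exists2 u : 'rV[R]_n -> R, sphere q c u &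
    (energy q p u <= (C1 * c `^ 2 * l `^ (- 2) + (C2 * c `^ q - C3 * c `^ p) * l `^ (- beta))%:E)%E].
Proof.
have nN : (0 < n)%N by rewrite -(ltr0n R).
have [C [D [C0 D0 hCD]]] := @competitor_exists R n nN.
exists (2^-1 * C `^ 2 * 5 ^+ n), (q^-1 * C `^ q * 5 ^+ n), (p^-1 * D `^ p / 2 ^+ n); split;
  [by rewrite !mulr_gt0 ?powR_gt0 ?exprn_gt0|by rewrite !mulr_gt0 ?invr_gt0 ?powR_gt0 ?exprn_gt0
  |by rewrite !mulr_gt0 ?invr_gt0 ?powR_gt0 ?exprn_gt0|].
move=> c l c0 l0; have [u [tu u2 ufin ugrad ulow]] := hCD c l c0 l0.
have wd : weakly_differentiable u by exists (grad u); exact: is_weak_gradient_grad.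
have gfin r : 0 < r -> (\int[mu]_x (`|gradient_norm u x| `^ r)%:E < +oo)%E.
  by move=> r0; exact: le_lt_trans (ugrad r r0) (ltry _).
have mg := measurable_gradient_norm wd.
have mu_ := measurable_test_function tu.
have su : sphere q c u.
{ split; last by rewrite poweR_normL.
  split; split.
  - by apply/LfunP_integral => //; split => //; exact: ufin.
  - by split=> //; apply/LfunP_integral => //; split => //; exact: gfin.
  - by apply/LfunP_integral => //; split => //; exact: ufin.
  - by split=> //; apply/LfunP_integral => //; split => //; exact: gfin. }
exists u => //.
have [a2 a20 a2E] := ge0_integral_fineK (gfin _ (ltr0Sn _ 1)).
have [aq aq0 aqE] := ge0_integral_fineK (gfin _ q0).
have [b b0 bE] := ge0_integral_fineK (ufin _ p0).
rewrite (energyE a2E aqE bE) lee_fin.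
have := ugrad _ (ltr0Sn _ 1); rewrite a2E lee_fin.
have := ugrad _ q0; rewrite aqE lee_fin.
have := ulow _ p0; rewrite bE lee_fin.
have -> : n%:R - p * (n%:R / 2) = - beta by field.
have -> : n%:R - q * (n%:R / 2 + 1) = - beta by rewrite pE; field; rewrite ?gt_eqF.
have -> : n%:R - 2 * (n%:R / 2 + 1) = - 2 :> R by field.
rewrite !powRM ?(ltW C0) ?(ltW c0) ?(ltW D0)// => hb hq h2.
have hb' : p^-1 * (D `^ p * c `^ p / 2 ^+ n * l `^ (- beta)) <= p^-1 * b.
  by rewrite ler_wpM2l// invr_ge0 ltW.
have hq' : q^-1 * aq <= q^-1 * (C `^ q * c `^ q * 5 ^+ n * l `^ (- beta)).
  by rewrite ler_wpM2l// invr_ge0 ltW.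
have h2' : 2^-1 * a2 <= 2^-1 * (C `^ 2 * c `^ 2 * 5 ^+ n * l `^ (- 2)).
  by rewrite ler_wpM2l.
apply: (@le_trans _ _ (2^-1 * (C `^ 2 * c `^ 2 * 5 ^+ n * l `^ (- 2)) +
   q^-1 * (C `^ q * c `^ q * 5 ^+ n * l `^ (- beta)) -
   p^-1 * (D `^ p * c `^ p / 2 ^+ n * l `^ (- beta)))).
  by lra.
by rewrite le_eqVlt; apply/orP; left; apply/eqP; ring.
Qed.

End energy.

(** * The two mass regimes *)

Lemma powR_neg_le {R : realType} (a b e l : R) : 0 < a -> 0 < b -> 0 < e -> 0 < l ->
  (a / e) `^ b^-1 <= l -> a * l `^ (- b) <= e.
Proof.
move=> a0 b0 e0 l0 hl; rewrite powRN ler_pdivrMr ?powR_gt0// mulrC -ler_pdivrMr//.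
have -> : a / e = ((a / e) `^ b^-1) `^ b.
  by rewrite -powRrM mulVf ?gt_eqF// powRr1// divr_ge0// ltW.
by apply: ge0_ler_powR; rewrite ?nnegrE ?powR_ge0 ?(ltW b0) ?(ltW l0).
Qed.

Theorem theorem1p3 (R : realType) (N : nat) (q p : R)
  (hN : (2 < N)%N) (hq : 1 < q < N%:R) (hq2 : q != 2)
  (hp : p = q * (1 + 2 / N%:R))
  (hp2 : 2 < p < Num.min (sobolev_exponent N 2) (sobolev_exponent N q)) :
  exists c1 c2 : R,
    [/\ 0 < c1 < c2,
        forall c : R, 0 < c <= c1 ->
          min_energy N q p c = 0%E /\ ~ (exists u : 'rV[R]_N -> R, minimizer q p c u) &
        2 < q < N%:R -> forall c : R, c2 < c ->
          min_energy N q p c = -oo%E /\ ~ (exists u : 'rV[R]_N -> R, minimizer q p c u)].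
Proof.
have {}hp2 : 2 < p /\ p < sobolev_exponent N q.
  by move: hp2; rewrite lt_min => /andP[-> /andP[_ ->]].
case: hp2 => p2 ps.
have [q1 qN] := andP hq.
have q0 : 0 < q by exact: lt_trans q1.
have p0 : 0 < p by exact: lt_trans p2.
have N0 : 0 < N%:R :> R by rewrite ltr0n (ltn_trans _ hN).
have [C1 [C2 [C3 [C10 C20 C30 hC]]]] := competitor_energy hq hp p2 ps.
(* A positive upper bound for the Gagliardo-Nirenberg constant. *)
pose K := `|gn_cst N q p (sobolev_exponent N q)| + 1.
have K0 : 0 < K by rewrite ltr_wpDl.
pose m := p / (2 * q * K).
have m0 : 0 < m by rewrite divr_gt0// !mulr_gt0.
pose c1 := m `^ (N%:R / (2 * q)).
have c10 : 0 < c1 by exact: powR_gt0.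
(* The second entry is the [c] at which [C2 * c]^ q = C3 * c [^ p]; the first ensures [c1 < c2]. *)
pose c2 := Num.max (c1 + 1) ((C2 / C3) `^ (p - q)^-1).
have c12 : c1 < c2 by rewrite lt_max ltrDl ltr01.
pose beta := N%:R * p / 2 - N%:R.
have beta0 : 0 < beta.
  by rewrite /beta subr_gt0 ltr_pdivlMr// ltr_pM2l.
have c1m : (c1 ^+ 2) `^ (q / N%:R) = m.
  rewrite -powR_mulrn ?(ltW c10)// /c1 -!powRrM (_ : _ * _ = 1) ?powRr1 ?(ltW m0)//.
  by field; rewrite !gt_eqF.
exists c1, c2; split; first by rewrite c10.
- move=> c /andP[c0 cc1].
  have pos (u : 'rV[R]_N -> R) : sphere q c u -> (0 < energy q p u)%E.
    move=> su; apply: (small_mass_energy hq hp p2 ps c0 _ su).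
    have cm : (c ^+ 2) `^ (q / N%:R) <= m.
      rewrite -c1m; apply: ge0_ler_powR; rewrite ?nnegrE ?exprn_ge0 ?(ltW c0) ?(ltW c10)//.
        by rewrite divr_ge0// ltW.
      by rewrite lerXn2r ?nnegrE ?(ltW c0) ?(ltW c10).
    apply: (@le_lt_trans _ _ (q * (K * m))).
      rewrite ler_wpM2l ?(ltW q0)//; apply: (@le_trans _ _ (K * (c ^+ 2) `^ (q / N%:R))).
        by rewrite ler_wpM2r ?powR_ge0// (le_trans (ler_norm _))// lerDl.
      by rewrite ler_wpM2l ?(ltW K0).
    rewrite [ltLHS](_ : _ = p / 2); last by rewrite /m; field; rewrite !gt_eqF.
    by rewrite ltr_pdivrMr// ltr_pMr// ltr1n.
  have inf0 : min_energy N q p c = 0%E.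
    apply/eqP; rewrite eq_le; apply/andP; split; last first.
      by apply: le_ereal_inf_tmp => _ [u su <-]; exact/ltW/pos.
    apply/lee_addgt0Pr => e e0; rewrite add0e.
    have e20 : 0 < e / 2 by rewrite divr_gt0.
    pose a1 := C1 * c `^ 2; pose a2 := C2 * c `^ q.
    have a10 : 0 < a1 by rewrite mulr_gt0 ?powR_gt0.
    have a20 : 0 < a2 by rewrite mulr_gt0 ?powR_gt0.
    (* Each of the two positive terms of the energy bound drops below [e / 2]; the third is negative
       and is discarded. *)
    pose l := Num.max ((a1 / (e / 2)) `^ 2^-1) ((a2 / (e / 2)) `^ beta^-1).
    have l0 : 0 < l by rewrite lt_max !powR_gt0 ?divr_gt0.
    have [u su hu] := hC c l c0 l0.
    apply: ge_ereal_inf; exists (energy q p u); first by exists u.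
    apply: (le_trans hu); rewrite lee_fin.
    have h1 : a1 * l `^ (- 2) <= e / 2 by apply: powR_neg_le => //; rewrite le_max lexx.
    have h2 : a2 * l `^ (- beta) <= e / 2 by apply: powR_neg_le => //; rewrite le_max lexx orbT.
    have h3 : 0 <= C3 * c `^ p * l `^ (- beta) by rewrite !mulr_ge0 ?powR_ge0 ?(ltW C30).
    rewrite -/a1 -/a2 -/beta mulrBl; lra.
  split => // -[u [su]]; rewrite inf0 => u0.
  by have := pos u su; rewrite u0 ltxx.
- move=> /andP[q2 _] c cc2.
  have c0 : 0 < c by exact: lt_trans (lt_trans c10 c12) cc2.
  have pq : 0 < p - q.
    by rewrite hp mulrDr mulr1 addrAC subrr add0r mulr_gt0 ?divr_gt0.
  have infNy : min_energy N q p c = -oo%E.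
    pose D := C3 * c `^ p - C2 * c `^ q.
    have D0 : 0 < D.
      have cp : c `^ p = c `^ (p - q) * c `^ q.
        by rewrite -powRD ?(gt_eqF c0) ?implybT// subrK.
      rewrite /D cp subr_gt0 mulrA ltr_pM2r ?powR_gt0// -ltr_pdivrMl// mulrC.
      have -> : C2 / C3 = ((C2 / C3) `^ (p - q)^-1) `^ (p - q).
        by rewrite -powRrM mulVf ?gt_eqF// powRr1// divr_ge0// ltW.
      apply: gt0_ltr_powR; rewrite ?nnegrE ?powR_ge0 ?(ltW c0)//.
      by move: cc2; rewrite gt_max => /andP[].
    (* Here [q > 2] is used: for small [l] the power [l]^ (- beta)[then dominates]l [^ (- 2)]. *)
    have b2 : 0 < beta - 2.
      rewrite /beta hp (_ : _ - 2 = (q - 2) * (N%:R / 2 + 1)); last by field; rewrite gt_eqF.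
      by rewrite mulr_gt0 ?subr_gt0// ltr_wpDl ?divr_ge0 ?(ltW N0).
    suff hA : forall A : R, (min_energy N q p c <= A%:E)%E.
      by case: (min_energy N q p c) hA => [r /(_ (r - 1))|/(_ 0)|]//; rewrite lee_fin => h; exfalso; lra.
    move=> A.
    pose a1 := C1 * c `^ 2.
    have a10 : 0 < a1 by rewrite mulr_gt0 ?powR_gt0.
    (* The dilation is [l = k^-1]. The choice gives [D * k]^ (beta - 2) >= a1 + [|A|], so the energy
       is at most [-]|A| * k [^ 2], and [k >= 1] brings this below [A]. *)
    pose k := Num.max 1 (((a1 + `|A|) / D) `^ (beta - 2)^-1).
    have k1 : 1 <= k by rewrite le_max lexx.
    have k0 : 0 < k by exact: lt_le_trans k1.
    have [u su hu] := hC c k^-1 c0 (etrans (invr_gt0 _) k0).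
    apply: ge_ereal_inf; exists (energy q p u); first by exists u.
    apply: (le_trans hu); rewrite lee_fin -/a1 -/beta.
    have inv z : k^-1 `^ (- z) = k `^ z.
      by rewrite -powR_inv1 ?(ltW k0)// -powRrM mulN1r opprK.
    rewrite !inv.
    have kb : k `^ beta = k `^ (beta - 2) * k `^ 2.
      by rewrite -powRD ?(gt_eqF k0) ?implybT// subrK.
    have hk : a1 + `|A| <= D * k `^ (beta - 2).
      rewrite mulrC -ler_pdivrMr//.
      have a1A : 0 <= (a1 + `|A|) / D by rewrite divr_ge0 ?(ltW D0)// addr_ge0 ?(ltW a10).
      have -> : (a1 + `|A|) / D = (((a1 + `|A|) / D) `^ (beta - 2)^-1) `^ (beta - 2).
        by rewrite -powRrM mulVf ?gt_eqF// powRr1.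
      apply: ge0_ler_powR; rewrite ?nnegrE ?powR_ge0 ?(ltW k0) ?(ltW b2)//.
      by rewrite le_max lexx orbT.
    have k2 : 1 <= k `^ 2 by rewrite powR_mulrn ?(ltW k0)// exprn_ege1.
    have -> : C2 * c `^ q - C3 * c `^ p = - D by rewrite /D opprB.
    rewrite kb.
    have h1 : (a1 + `|A|) * k `^ 2 <= D * k `^ (beta - 2) * k `^ 2.
      by rewrite ler_wpM2r ?powR_ge0.
    have h2 : `|A| <= `|A| * k `^ 2 by rewrite ler_peMr.
    have h3 : - `|A| <= A by rewrite lerNl -normrN ler_norm.
    by move: h1; rewrite mulrDl; lra.
  (* A minimizer would have energy [-oo], but every element of the sphere has finite energy. *)
  split => // -[u [su]]; rewrite infNy => u0.
  by have := sphere_energy_Ny hq hp p2 ps c0 su; rewrite u0.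
Qed.
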